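(* Let $\Phi$ be a Turing functional such that the induced semi-measure $\rho=\lambda_\Phi$ is computable. If $Y\in\mathsf{MLR}_\rho$, then there is some $X\in\mathsf{MLR}$ with $X\in\mathrm{dom}(\Phi)$ and $\Phi(X)=Y$.
   Context: $2^\omega$ is Cantor space, $2^{<\omega}$ the set of finite binary strings, $\preceq$ the prefix order, $\varepsilon$ the empty string, $[\![\sigma]\!]=\{X\in2^\omega:\sigma\preceq X\}$ and $[\![S]\!]=\bigcup_{\sigma\in S}[\![\sigma]\!]$; $\lambda$ is the uniform measure. A Turing functional $\Phi$ is a c.e. set of pairs $(\sigma,\tau)$ of strings such that whenever $(\sigma,\tau),(\sigma',\tau')\in\Phi$ and $\sigma\preceq\sigma'$, $\tau,\tau'$ are comparable. For $X\in2^\omega$, $\Phi^X$ is the maximal finite or infinite sequence extending every $\tau$ with $(\sigma,\tau)\in\Phi$ for some $\sigma\preceq X$; $\mathrm{dom}(\Phi)=\{X:\Phi^X\text{ infinite}\}$ and $\Phi(X)=\Phi^X$ for $X\in\mathrm{dom}(\Phi)$. The induced semi-measure is $\lambda_\Phi(\sigma)=\lambda(\{X:\Phi^X\succeq\sigma\})$. A semi-measure is $\rho:2^{<\omega}\to[0,1]$ with $\rho(\varepsilon)=1$ and $\rho(\sigma)\ge\rho(\sigma0)+\rho(\sigma1)$; it is computable if its values are uniformly computable reals. For $E\subseteq 2^{<\omega}$, $\rho(E)=\sum_{\sigma\in E}\rho(\sigma)$. A $\rho$-Martin-Löf test is a uniformly c.e. sequence $(U_i)_{i\in\omega}$ of subsets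 of $2^{<\omega}$ with $\rho(U_i)\le2^{-i}$; $X\in\mathsf{MLR}_\rho$ iff $X\notin\bigcap_i[\![U_i]\!]$ for every such test. $\mathsf{MLR}$ is the set of Martin-Löf random sequences for $\lambda$. *)

(* Defs.v *)
From HB Require Import structures.
From mathcomp Require Import all_boot all_order all_algebra.
From mathcomp Require Import all_classical all_reals.
From mathcomp Require Import ereal esum.
Set Implicit Arguments. Unset Strict Implicit. Unset Printing Implicit Defensive.
Import Order.TTheory GRing.Theory Num.Theory.
Local Open Scope classical_set_scope.
Local Open Scope ring_scope.

Inductive prf : Type :=
| PZero : prf
| PSucc : prf
| PProj : nat -> prf
| PComp : prf -> list prf -> prf
| PPrec : prf -> prf -> prf
| PMu   : prf -> prf.

Inductive eval : prf -> seq nat -> nat -> Prop :=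
| eZero v : eval PZero v 0
| eSucc v : eval PSucc v (head 0%N v).+1
| eProj i v : eval (PProj i) v (nth 0%N v i)
| eComp f gs v ws y : evals gs v ws -> eval f ws y -> eval (PComp f gs) v y
| ePrec0 f g v y : eval f v y -> eval (PPrec f g) (0%N :: v) y
| ePrecS f g n v r y : eval (PPrec f g) (n :: v) r ->
    eval g (n :: r :: v) y -> eval (PPrec f g) (n.+1 :: v) y
| eMu f v n : eval f (n :: v) 0 ->
    (forall m, (m < n)%N -> exists k, (0 < k)%N /\ eval f (m :: v) k) ->
    eval (PMu f) v n
with evals : list prf -> seq nat -> seq nat -> Prop :=
| esNil v : evals nil v [::]
| esCons g gs v y ys : eval g v y -> evals gs v ys -> evals (g :: gs) v (y :: ys).

Definition halts (f : prf) (v : seq nat) : Prop := exists y, eval f v y.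

Definition str := seq bool.
Definition cantor := nat -> bool.

(* bijective coding of binary strings by naturals *)
Fixpoint code (s : str) : nat :=
  match s with [::] => 0%N | b :: s' => (2 * code s' + 1 + b)%N end.

Definition pre (s : str) (X : cantor) : Prop :=
  forall i, (i < size s)%N -> nth false s i = X i.

Definition cyl (S : set str) : set cantor := [set X | exists2 s, S s & pre s X].

Definition turing_functional (Phi : str -> str -> Prop) : Prop :=
  (exists f : prf, forall s t, Phi s t <-> halts f [:: code s; code t]) /\
  (forall s t s' t', Phi s t -> Phi s' t' -> prefix s s' ->
       prefix t t' || prefix t' t).

Definition PhiX (Phi : str -> str -> Prop) (X : cantor) (n : nat) (b : bool) :=
  exists s t, [/\ Phi s t, pre s X, (n < size t)%N & nth false t n = b].

Definition PhiX_ext Phi X (s : str) : Prop :=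
  forall i, (i < size s)%N -> PhiX Phi X i (nth false s i).

Definition in_dom Phi (X : cantor) : Prop := forall n, exists b, PhiX Phi X n b.

Definition Phi_maps Phi (X Y : cantor) : Prop := forall n, PhiX Phi X n (Y n).

Definition lam {R : realType} (A : set cantor) : \bar R :=
  ereal_inf [set esum S (fun s : str => ((2%:R : R) ^- size s)%:E)
            | S in [set S : set str | A `<=` cyl S]].

Definition lamPhi {R : realType} Phi (s : str) : \bar R :=
  lam [set X | PhiX_ext Phi X s].

Definition computable_fun {R : realType} (rho : str -> R) : Prop :=
  exists p m : prf, forall s n, exists a b,
    [/\ eval p [:: code s; n] a, eval m [:: code s; n] b &
        `|rho s - (a%:R - b%:R) / (2%:R ^+ n)| <= (2%:R : R) ^- n].

Definition unif_ce (U : nat -> set str) : Prop :=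
  exists f : prf, forall i s, U i s <-> halts f [:: i; code s].

(* rho(U_i) <= 2^-i, i.e. every finite partial sum is bounded *)
Definition ML_test {R : realType} (rho : str -> R) (U : nat -> set str) : Prop :=
  unif_ce U /\
  forall i (l : seq str), uniq l -> (forall s, s \in l -> U i s) ->
     \sum_(s <- l) rho s <= (2%:R : R) ^- i.

Definition MLR_rho {R : realType} (rho : str -> R) (Y : cantor) : Prop :=
  forall U, ML_test rho U -> ~ (forall i, cyl (U i) Y).

Definition MLR {R : realType} (X : cantor) : Prop :=
  MLR_rho (fun s : str => (2%:R : R) ^- size s) X.

(* Main.v *)
(* Write A_s = {X : Phi^X extends s}; these sets are uniformly c.e. open, of measure rho(s).

   Key estimate: if (O_c) is a uniformly c.e. family of open sets with measure(O_c) <= 2^-c and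
   k is fixed, then some c satisfies measure(O_c /\ A_s) <= 2^-k rho(s) for every prefix s of Y.
   Indeed "measure(O_c /\ A_s) > 2^-k rho(s)" is a c.e. condition because rho is computable, and
   since the sets A_s of the minimal strings s satisfying it are disjoint, these strings have total
   rho-weight at most 2^k 2^-c; failure for every c would give a rho-test capturing Y.

   There are countably many Martin-Loef tests for the uniform measure.  Applying the estimate to
   the j-th one with k = j + 2 yields an open set W, containing a component of every test, which
   covers at most half of each A_s, s a prefix of Y; hence each A_s has a point outside W and no
   universal test is needed.  To pass to the limit by compactness, one more family is put into W:
   as measure(A_s) = rho(s) is computable, one can compute a stage at which almost all of A_s has
   been enumerated, and the points that enter later form a small c.e. open set, outside of which
   every A_s is clopen. *)

Require Import Defs.
From mathcomp Require Import all_boot all_order all_algebra.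
From mathcomp Require Import all_classical all_reals.
From mathcomp Require Import ereal esum.
From mathcomp Require Import finmap zify ring lra.
Import Order.TTheory GRing.Theory Num.Theory.
(* The libraries above shadow [code] and [eval]. *)
Import Defs.
Set Implicit Arguments. Unset Strict Implicit. Unset Printing Implicit Defensive.

Local Open Scope classical_set_scope.
Local Open Scope nat_scope.

(** * Recursive functions *)

(* The last variable of a context is the first argument of the function, as [PPrec] and [PMu]
   bind it. *)
Fixpoint ctx (n : nat) : Type := if n is m.+1 then (ctx m * nat)%type else unit.

Fixpoint env (n : nat) : ctx n -> seq nat :=
  match n with
  | 0 => fun _ => [::]
  | m.+1 => fun x : ctx m * nat => x.2 :: env x.1
  end.

Lemma size_env n (x : ctx n) : size (env x) = n.
Proof. by elim: n x => //= n IH [x a] /=; rewrite IH. Qed.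

(** Only derivability of the value is asked; that [eval] is single-valued is extracted from
    [fueled_all] where [dec_halts] calls for it. *)
Definition cmp n (F : ctx n -> nat) : Prop :=
  exists p, forall x, eval p (env x) (F x).

Definition cmpv n m (W : ctx n -> ctx m) : Prop :=
  exists ps, forall x, evals ps (env x) (env (W x)).

Lemma cmp_ext n (F G : ctx n -> nat) : F =1 G -> cmp F -> cmp G.
Proof. by move=> e [p hp]; exists p => x; rewrite -e. Qed.

Lemma cmp_var i n : cmp (fun x : ctx n => nth 0 (env x) i).
Proof. by exists (PProj i) => x; constructor. Qed.

Lemma cmpv_id n : cmpv (fun x : ctx n => x).
Proof.
exists (map PProj (iota 0 n)) => x.
rewrite -[X in evals _ _ X](mkseq_nth 0) /mkseq size_env.
by elim: (iota 0 n) => [|i s IH] /=; [exact: esNil | apply: esCons => //; exact: eProj].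
Qed.

Lemma cmpv_nil n : cmpv (m := 0) (fun _ : ctx n => tt).
Proof. by exists nil => x; constructor. Qed.

Lemma cmpv_cons n m (W : ctx n -> ctx m) g :
  cmpv W -> cmp g -> cmpv (m := m.+1) (fun x => (W x, g x)).
Proof. by move=> [ps hps] [p hp]; exists (p :: ps) => x; constructor. Qed.

Lemma cmp_comp n m (W : ctx n -> ctx m) f :
  cmpv W -> cmp f -> cmp (fun x => f (W x)).
Proof. by move=> [ps hps] [p hp]; exists (PComp p ps) => x; econstructor. Qed.

Lemma cmp_succ n (f : ctx n -> nat) : cmp f -> cmp (fun x => (f x).+1).
Proof.
move=> hf; apply: (cmp_comp (m := 1) (cmpv_cons (cmpv_nil _) hf) (f := fun y => y.2.+1)).
by exists PSucc => x; constructor.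
Qed.

Lemma cmp_const c n : cmp (fun _ : ctx n => c).
Proof.
elim: c => [|c IH]; last exact: cmp_succ IH.
by exists PZero => x; constructor.
Qed.

Lemma cmpv_comp n m k (V : ctx n -> ctx m) (W : ctx m -> ctx k) :
  cmpv V -> cmpv W -> cmpv (fun x => W (V x)).
Proof.
move=> [vs hvs] [ws hws]; exists [seq PComp q vs | q <- ws] => x.
have := hws (V x); elim: ws (env (W (V x))) {hws} => [|q ws IH] s h; inversion h; subst.
  exact: esNil.
by constructor; [econstructor; [exact: hvs|] | exact: IH].
Qed.

Lemma cmpv_fst n : cmpv (fun x : ctx n.+1 => x.1 : ctx n).
Proof.
exists (map PProj (iota 1 n)) => -[x a] /=.
rewrite -[X in evals _ _ X](mkseq_nth 0) /mkseq size_env.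
rewrite (iotaDl 1 0) -map_comp.
by elim: (iota 0 n) => [|i s IH] /=; [exact: esNil | apply: esCons => //; exact: eProj].
Qed.

Lemma cmpv_weak n m (W : ctx n -> ctx m) : cmpv W -> cmpv (fun x : ctx n.+1 => W x.1).
Proof. exact: cmpv_comp (cmpv_fst n). Qed.

Lemma cmp_weak n (f : ctx n -> nat) : cmp f -> cmp (fun x : ctx n.+1 => f x.1).
Proof. exact: cmp_comp (cmpv_fst n). Qed.

(** Stated with [nat_rect] so that [cmp_ext] can match arithmetic functions against it. In [ctx]
    order the step sees parameters, previous value, counter: the reverse of the list in [ePrecS]. *)
Lemma cmp_rec n (G : ctx n -> nat) (H : ctx n -> nat -> nat -> nat) F :
  cmp G -> cmp (fun y : ctx n.+2 => H y.1.1 y.2 y.1.2) -> cmp F ->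
  cmp (fun x => nat_rect (fun _ => nat) (G x) (H x) (F x)).
Proof.
move=> [g hg] [h hh] hF.
apply: (cmp_comp (m := n.+1) (cmpv_cons (cmpv_id n) hF)
  (f := fun y => nat_rect (fun _ => nat) (G y.1) (H y.1) y.2)).
exists (PPrec g h) => -[x k] /=; elim: k => [|k IH] /=; first by constructor.
by econstructor; [exact: IH | exact: (hh ((x, _), k))].
Qed.

Lemma cmp_comp1 (h : nat -> nat) n (f : ctx n -> nat) :
  cmp (fun y : ctx 1 => h y.2) -> cmp f -> cmp (fun x => h (f x)).
Proof.
move=> hh hf.
exact: (cmp_comp (m := 1) (cmpv_cons (cmpv_nil _) hf) hh).
Qed.

Lemma cmp_comp2 (h : nat -> nat -> nat) n (f g : ctx n -> nat) :
  cmp (fun y : ctx 2 => h y.1.2 y.2) -> cmp f -> cmp g ->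
  cmp (fun x => h (f x) (g x)).
Proof.
move=> hh hf hg.
exact: (cmp_comp (m := 2) (cmpv_cons (cmpv_cons (cmpv_nil _) hf) hg) hh).
Qed.

Lemma cmp_comp3 (h : nat -> nat -> nat -> nat) n (f g k : ctx n -> nat) :
  cmp (fun y : ctx 3 => h y.1.1.2 y.1.2 y.2) -> cmp f -> cmp g -> cmp k ->
  cmp (fun x => h (f x) (g x) (k x)).
Proof.
move=> hh hf hg hk.
exact: (cmp_comp (m := 3)
  (cmpv_cons (cmpv_cons (cmpv_cons (cmpv_nil _) hf) hg) hk) hh).
Qed.

Ltac cvar := first [ exact: (@cmp_var 0 _) | exact: (@cmp_var 1 _)
  | exact: (@cmp_var 2 _) | exact: (@cmp_var 3 _) | exact: (@cmp_var 4 _)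
  | exact: (@cmp_var 5 _) ].

Lemma cmp_add n (f g : ctx n -> nat) : cmp f -> cmp g -> cmp (fun x => f x + g x).
Proof.
apply: (@cmp_comp2 addn).
apply: (@cmp_ext _ (fun y : ctx 2 => nat_rect (fun _ => nat) y.1.2 (fun _ r => r.+1) y.2)).
  by move=> [[[] a] b] /=; elim: b => [|b /= ->]; rewrite ?addn0 ?addnS.
by apply: cmp_rec; [cvar | apply: cmp_succ; cvar | cvar].
Qed.

Lemma cmp_mul n (f g : ctx n -> nat) : cmp f -> cmp g -> cmp (fun x => f x * g x).
Proof.
apply: (@cmp_comp2 muln).
apply: (@cmp_ext _ (fun y : ctx 2 => nat_rect (fun _ => nat) 0 (fun _ r => y.1.2 + r) y.2)).
  by move=> [[[] a] b] /=; elim: b => [|b /= ->]; rewrite ?muln0 ?mulnS.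
by apply: cmp_rec; [exact: cmp_const | apply: cmp_add; cvar | cvar].
Qed.

Lemma cmp_exp n (f g : ctx n -> nat) : cmp f -> cmp g -> cmp (fun x => f x ^ g x).
Proof.
apply: (@cmp_comp2 expn).
apply: (@cmp_ext _ (fun y : ctx 2 => nat_rect (fun _ => nat) 1 (fun _ r => y.1.2 * r) y.2)).
  by move=> [[[] a] b] /=; elim: b => [|b /= ->]; rewrite ?expn0 ?expnS.
by apply: cmp_rec; [exact: cmp_const | apply: cmp_mul; cvar | cvar].
Qed.

Lemma cmp_pred n (f : ctx n -> nat) : cmp f -> cmp (fun x => (f x).-1).
Proof.
apply: (@cmp_comp1 predn).
apply: (@cmp_ext _ (fun y : ctx 1 => nat_rect (fun _ => nat) 0 (fun k _ => k) y.2)).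
  by move=> [[] [|a]].
by apply: cmp_rec; [exact: cmp_const | cvar | cvar].
Qed.

Lemma cmp_sub n (f g : ctx n -> nat) : cmp f -> cmp g -> cmp (fun x => f x - g x).
Proof.
apply: (@cmp_comp2 subn).
apply: (@cmp_ext _ (fun y : ctx 2 => nat_rect (fun _ => nat) y.1.2 (fun _ r => r.-1) y.2)).
  by move=> [[[] a] b] /=; elim: b => [|b /= ->]; rewrite ?subn0 ?subnS.
by apply: cmp_rec; [cvar | apply: cmp_pred; cvar | cvar].
Qed.

(** * Decidable predicates *)

Definition dec n (P : ctx n -> bool) : Prop := cmp (fun x => nat_of_bool (P x)).

Lemma dec_neg n (P : ctx n -> bool) : dec P -> dec (fun x => ~~ P x).
Proof.
move=> hP; apply: (@cmp_ext _ (fun x => 1 - P x)); first by move=> x; case: (P x).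
by apply: cmp_sub => //; exact: cmp_const.
Qed.

Lemma dec_and n (P Q : ctx n -> bool) : dec P -> dec Q -> dec (fun x => P x && Q x).
Proof.
move=> hP hQ; apply: (@cmp_ext _ (fun x => P x * Q x)).
  by move=> x; case: (P x) => /=; rewrite ?mul1n.
exact: cmp_mul.
Qed.

Lemma dec_or n (P Q : ctx n -> bool) : dec P -> dec Q -> dec (fun x => P x || Q x).
Proof.
move=> hP hQ; apply: (@cmp_ext _ (fun x => ~~ (~~ P x && ~~ Q x))).
  by move=> x; case: (P x); case: (Q x).
by apply: dec_neg; apply: dec_and; apply: dec_neg.
Qed.

Lemma dec_leq n (f g : ctx n -> nat) : cmp f -> cmp g -> dec (fun x => f x <= g x).
Proof.
move=> hf hg; apply: (@cmp_ext _ (fun x => 1 - (f x - g x))).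
  by move=> x; rewrite /leq; case: (f x - g x) => [|[]].
by apply: cmp_sub; [exact: cmp_const | exact: cmp_sub].
Qed.

Lemma dec_eq n (f g : ctx n -> nat) : cmp f -> cmp g -> dec (fun x => f x == g x).
Proof.
move=> hf hg; apply: (@cmp_ext _ (fun x => (f x <= g x) && (g x <= f x))).
  by move=> x; rewrite eqn_leq.
by apply: dec_and; exact: dec_leq.
Qed.

Lemma cmp_if n (P : ctx n -> bool) f g :
  dec P -> cmp f -> cmp g -> cmp (fun x => if P x then f x else g x).
Proof.
move=> hP hf hg; apply: (@cmp_ext _ (fun x => P x * f x + (~~ P x) * g x)).
  by move=> x; case: (P x); rewrite /= ?mul1n ?mul0n ?addn0.
by apply: cmp_add; apply: cmp_mul => //; exact: dec_neg.
Qed.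

Lemma cmp_count n (P : ctx n -> nat -> bool) F :
  dec (fun y : ctx n.+1 => P y.1 y.2) -> cmp F ->
  cmp (fun x => count (P x) (iota 0 (F x))).
Proof.
move=> hP hF.
apply: (@cmp_ext _ (fun x => nat_rect (fun _ => nat) 0 (fun k r => r + P x k) (F x))).
  move=> x; elim: (F x) => // k IH.
  by rewrite -[X in iota 0 X]addn1 iotaD count_cat -IH /= addn0.
apply: cmp_rec => //; first exact: cmp_const.
apply: cmp_add; first cvar.
apply: (cmp_comp (m := n.+1) (W := fun y : ctx n.+2 => (y.1.1, y.2)) _ hP).
apply: cmpv_cons; last cvar.
exact: cmpv_weak (cmpv_fst n).
Qed.

Lemma dec_has n (P : ctx n -> nat -> bool) F :
  dec (fun y : ctx n.+1 => P y.1 y.2) -> cmp F ->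
  dec (fun x => has (P x) (iota 0 (F x))).
Proof.
move=> hP hF; apply: (@cmp_ext _ (fun x => 0 < count (P x) (iota 0 (F x)))).
  by move=> x; rewrite has_count.
by apply: dec_leq; [exact: cmp_const | exact: cmp_count].
Qed.

(** * Evaluation with fuel and normal forms for halting *)

Fixpoint prf_ind_nested (P : prf -> Prop) (Q : seq prf -> Prop)
  (hZ : P PZero) (hS : P PSucc) (hP : forall i, P (PProj i))
  (hC : forall f gs, P f -> Q gs -> P (PComp f gs))
  (hR : forall f g, P f -> P g -> P (PPrec f g)) (hM : forall f, P f -> P (PMu f))
  (hn : Q [::]) (hc : forall g gs, P g -> Q gs -> Q (g :: gs)) (f : prf) : P f :=
  let rec := prf_ind_nested hZ hS hP hC hR hM hn hc in
  match f with
  | PZero => hZ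
  | PSucc => hS
  | PProj i => hP i
  | PComp f gs => hC f gs (rec f)
      (* The generated principle gives no hypothesis for the arguments of [PComp]; this inner
         recursion over the list supplies it. *)
      ((fix go gs := match gs return Q gs with
        | nil => hn
        | g :: gs' => hc g gs' (rec g) (go gs') end) gs)
  | PPrec f g => hR f g (rec f) (rec g)
  | PMu f => hM f (rec f)
  end.

(* [F (x, t)] is [y.+1] if f returns y within fuel t, and 0 if it does not return. *)
Definition fueled (f : prf) : Prop := forall n, exists F : ctx n.+1 -> nat,
  [/\ cmp F,
      forall x t u, t <= u -> 0 < F (x, t) -> F (x, u) = F (x, t) &
      forall x y, eval f (env x) y <-> exists t, F (x, t) = y.+1].

(** A tuple of values has no spare element to signal failure, so the flag [ok] takes over the role
    that the value 0 has in [fueled]. *)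
Definition fueleds (gs : seq prf) : Prop := forall n,
  exists (ok : ctx n.+1 -> bool) (W : ctx n.+1 -> ctx (size gs)),
  [/\ dec ok, cmpv W,
      forall x t u, t <= u -> ok (x, t) -> ok (x, u) /\ W (x, u) = W (x, t) &
      forall x ws, evals gs (env x) ws <-> exists2 t, ok (x, t) & env (W (x, t)) = ws].

Lemma fueled_total f : (forall n, exists2 F : ctx n -> nat, cmp F & 
   forall x y, eval f (env x) y <-> F x = y) -> fueled f.
Proof.
move=> h n; have [F cF hF] := h n.
exists (fun y => (F y.1).+1); split => //; first by apply: cmp_succ; exact: cmp_weak.
move=> x y; rewrite hF; split=> [<-|[_ [->]]//]; by exists 0.
Qed.

Lemma fueled_nil : fueleds [::].
Proof.
move=> n; exists (fun _ => true), (fun _ => tt); split=> //.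
- exact: (@cmp_const 1).
- exact: cmpv_nil.
- move=> x ws; split=> [h|[_ _ <-]]; last by constructor.
  by inversion h; exists 0.
Qed.

Lemma fueled_cons g gs : fueled g -> fueleds gs -> fueleds (g :: gs).
Proof.
move=> hg hgs n; have [F [cF mF eF]] := hg n.
have [ok [W [dok cW mW eW]]] := hgs n.
exists (fun y => (0 < F y) && ok y), (fun y => (W y, (F y).-1)); split.
- apply: dec_and => //; apply: dec_leq => //; exact: cmp_const.
- apply: cmpv_cons => //; exact: cmp_pred.
- move=> x t u tu /andP[h1 h2]; have [h3 h4] := mW _ _ _ tu h2.
  by rewrite (mF _ _ _ tu) // h1 h3 h4.
move=> x ws; split=> [h|[t /andP[h1 h2] <-]].
  inversion h; subst.
  have /eF[t1 e1] : eval g (env x) y by [].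
  have /eW[t2 o2 e2] : evals gs (env x) ys by [].
  exists (maxn t1 t2).
    by rewrite (mF _ t1) ?leq_maxl ?e1 //= (mW _ t2 _ (leq_maxr _ _) o2).1.
  by rewrite /= (mF _ t1) ?leq_maxl ?e1 //= (mW _ t2 _ (leq_maxr _ _) o2).2 e2.
constructor; first by apply/eF; exists t; rewrite prednK.
by apply/eW; exists t.
Qed.

Lemma fueled_comp f gs : fueled f -> fueleds gs -> fueled (PComp f gs).
Proof.
move=> hf hgs n; have [F [cF mF eF]] := hf (size gs).
have [ok [W [dok cW mW eW]]] := hgs n.
exists (fun y => if ok y then F (W y, y.2) else 0); split.
- apply: cmp_if => //; last exact: cmp_const.
  by apply: (cmp_comp (m := (size gs).+1) _ cF); apply: cmpv_cons => //; cvar.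
- move=> x t u tu; case: ifP => // o h.
  by have [-> ->] := mW _ _ _ tu o; apply: mF.
move=> x y; split=> [h|[t]].
  inversion h; subst.
  have /eW[t1 o1 e1] : evals gs (env x) ws by [].
  have : eval f (env (W (x, t1))) y by rewrite e1.
  case/eF=> t2 e2; exists (maxn t1 t2).
  have [-> ->] := mW _ _ _ (leq_maxl t1 t2) o1.
  by rewrite (mF _ t2) ?leq_maxr // e2.
case: ifP => // o e; econstructor; last by apply/eF; exists t; exact: e.
by apply/eW; exists t.
Qed.

Lemma fueled_rec f g : fueled f -> fueled g -> fueled (PPrec f g).
Proof.
move=> hf hg [|n].
  exists (fun _ => 0); split=> //; first exact: cmp_const.
  by move=> x y; split=> [h|[]//]; inversion h.
have [F [cF mF eF]] := hf n; have [G [cG mG eG]] := hg n.+2.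
(* One fuel [t] serves every level of the recursion; a failure, coded by 0, is passed upwards, and
   [r.-1] undoes the coding of a value. *)
pose K x t := nat_rect (fun _ => nat) (F (x, t))
   (fun k r => if 0 < r then G (((x, r.-1), k), t) else 0).
have mK x t u k : t <= u -> 0 < K x t k -> K x u k = K x t k.
  move=> tu; elim: k => [|k IH] /=; first exact: mF.
  case: (posnP (K x t k)) => // p; rewrite IH // p; exact: mG.
have vx : cmpv (fun y : ctx n.+2 => y.1.1 : ctx n) by exact: cmpv_weak (cmpv_fst n).
exists (fun y : ctx n.+2 => K y.1.1 y.2 y.1.2); split.
- apply: (@cmp_rec n.+2 (fun y => F (y.1.1, y.2))
    (fun y k r => if 0 < r then G (((y.1.1, r.-1), k), y.2) else 0)
    (fun y => y.1.2)); last cvar.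
    by apply: (cmp_comp (m := n.+1) _ cF); apply: cmpv_cons => //; cvar.
  apply: cmp_if; last exact: cmp_const.
    by apply: dec_leq; [exact: cmp_const | cvar].
  apply: (cmp_comp (m := n.+3) _ cG).
  apply: cmpv_cons; last cvar.
  apply: cmpv_cons; last cvar.
  apply: cmpv_cons; last by apply: cmp_pred; cvar.
  exact: cmpv_weak (cmpv_weak vx).
- by move=> [x k] t u; exact: mK.
move=> [x k] y; rewrite /= -/(env x); split.
  elim: k y => [|k IH] y h; inversion h; subst; first exact/eF.
  have /IH[t1 e1] : eval (PPrec f g) (k :: env x) r by [].
  have /eG[t2 e2] : eval g (env (((x, r), k) : ctx n.+2)) y by [].
  exists (maxn t1 t2).
  rewrite /= (mK _ t1) ?leq_maxl ?e1 //= (mG _ t2) ?leq_maxr ?e2 //.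
elim: k y => [|k IH] y [t /= e]; first by constructor; apply/eF; exists t.
move: e; case E : (K x t k) => [|r] //= e.
by econstructor; [apply: IH; exists t; exact: E | apply/(eG ((x, r), k)); exists t].
Qed.

Lemma fueled_mu f : fueled f -> fueled (PMu f).
Proof.
move=> hf n; have [F [cF mF eF]] := hf n.+1.
(* The counter moves past arguments at which f returns a positive value and stays at the first where
   f returns 0 or runs out of fuel; the test [== 1] below tells these two apart. There [t] is both
   the fuel and the bound of the search. *)
pose K x t k := nat_rect (fun _ => nat) 0
   (fun _ r => if F ((x, r), t) <= 1 then r else r.+1) k.
have vx : cmpv (fun y : ctx n.+1 => y.1 : ctx n) by exact: cmpv_fst.
have cK : cmp (fun y : ctx n.+1 => K y.1 y.2 y.2).
  apply: (@cmp_rec n.+1 (fun _ => 0)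
    (fun y _ r => if F ((y.1, r), y.2) <= 1 then r else r.+1) (fun y => y.2)).
  - exact: cmp_const.
  - apply: cmp_if; [|by cvar|by apply: cmp_succ; cvar].
    apply: dec_leq; last exact: cmp_const.
    apply: (cmp_comp (m := n.+2) _ cF).
    apply: cmpv_cons; last cvar.
    apply: cmpv_cons; last cvar.
    exact: cmpv_weak (cmpv_weak vx).
  - cvar.
have K1 x t k m : m < K x t k -> 1 < F ((x, m), t).
  elim: k => //= k IH; case: (leqP (F ((x, K x t k), t)) 1) => [_ /IH //|h].
  by rewrite ltnS leq_eqVlt => /orP[/eqP->|/IH].
have K2 x t k j : (forall m, m < j -> 1 < F ((x, m), t)) -> F ((x, j), t) <= 1 ->
    K x t k = minn k j.
  move=> h1 h2; elim: k => [|k IH] /=; first by rewrite min0n.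
  rewrite IH; case: (ltngtP k j) => [kj|jk|->].
  - by rewrite leqNgt h1 //=; move/minn_idPl: kj => ->.
  - have -> : minn k.+1 j = j by apply/minn_idPr; lia.
    by rewrite h2.
  - by rewrite h2; symmetry; apply/minn_idPr; lia.
exists (fun y => if F ((y.1, K y.1 y.2 y.2), y.2) == 1 then (K y.1 y.2 y.2).+1 else 0).
have mm x t u : t <= u -> F ((x, K x t t), t) = 1 -> K x u u = K x t t.
  move=> tu e1.
  have e2 : F ((x, K x t t), u) = 1 by rewrite (mF _ t) ?e1.
  rewrite (@K2 x u u (K x t t)) ?e2 //.
  - have : K x t t <= t.
      by rewrite (@K2 x t t (K x t t)) ?e1 ?geq_minl // => m /K1.
    lia.
  - move=> m /K1 h; rewrite (mF _ t) //; lia.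
split.
- apply: cmp_if; [|exact: cmp_succ|exact: cmp_const].
  apply: dec_eq; last exact: cmp_const.
  apply: (cmp_comp (m := n.+2) _ cF).
  by apply: cmpv_cons; [apply: cmpv_cons | cvar].
- move=> x t u tu /=; case: eqP => // e1 _.
  by rewrite (mm _ t) // (mF _ t) // e1.
move=> x y; split=> [h|[t /=]].
  inversion h; subst.
  have [t ht] : exists t, forall m, m < y -> 1 < F ((x, m), t).
    have : forall m, m < y -> exists k, 0 < k /\ eval f (m :: env x) k by [].
    elim: (y) => [|z IH] h'; first by exists 0.
    have [m mz|t1 h1] := IH; first by apply: h'; exact: ltnW.
    have [k [k0 /(eF (x, z))[t2 e2]]] := h' z (ltnSn z).
    exists (maxn t1 t2) => m; rewrite ltnS leq_eqVlt => /orP[/eqP->|my].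
      by rewrite (mF _ t2) ?leq_maxr ?e2.
    by rewrite (mF _ t1) ?leq_maxl ?h1 // ltnW ?h1.
  have /eF[t2 e2] : eval f (env ((x, y) : ctx n.+1)) 0 by [].
  pose u := maxn (maxn t t2) y; exists u => /=.
  have e3 : F ((x, y), u) = 1 by rewrite (mF _ t2) ?e2 //; lia.
  have -> : K x u u = y.
    rewrite (@K2 x u u y) ?e3 //; first by lia.
    by move=> m my; rewrite (mF _ t) ?ht //; [lia | rewrite ltnW ?ht].
  by rewrite e3.
case: eqP => // e1 [<-]; constructor; first by apply/(eF (x, _)); exists t.
move=> m /K1 h; exists (F ((x, m), t)).-1; split; first by rewrite ltn_predRL.
by apply/(eF (x, m)); exists t; rewrite prednK // ltnW.
Qed.

Lemma fueled_all f : fueled f.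
Proof.
apply: (@prf_ind_nested fueled fueleds) f.
- apply: fueled_total => n; exists (fun _ => 0); first exact: cmp_const.
  by move=> x y; split=> [h|<-]; [inversion h | constructor].
- apply: fueled_total => n; exists (fun x => (head 0 (env x)).+1).
    by apply: (@cmp_ext _ (fun x => (nth 0 (env x) 0).+1)); last exact/cmp_succ/cmp_var.
  by move=> x y; split=> [h|<-]; [inversion h | constructor].
- move=> i; apply: fueled_total => n; exists (fun x => nth 0 (env x) i).
    exact: cmp_var.
  by move=> x y; split=> [h|<-]; [inversion h | constructor].
- exact: fueled_comp.
- exact: fueled_rec.
- exact: fueled_mu.
- exact: fueled_nil.
- exact: fueled_cons.
Qed.

Lemma halts_dec n f : exists2 B : ctx n.+1 -> bool, dec B &
  forall x, halts f (env x) <-> exists t, B (x, t).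
Proof.
have [F [cF mF eF]] := fueled_all f n; exists (fun y => 0 < F y).
  by apply: dec_leq; [exact: cmp_const|].
move=> x; split=> [[y /eF[t e]]|[t h]]; first by exists t; rewrite e.
by exists (F (x, t)).-1; apply/eF; exists t; rewrite prednK.
Qed.

Lemma dec_halts n (B : ctx n.+1 -> bool) : dec B -> exists f, 
  forall x, halts f (env x) <-> exists t, B (x, t).
Proof.
move=> /dec_neg[p hp]; exists (PMu p) => x.
have ev t : eval p (t :: env x) (~~ B (x, t)) by exact: (hp (x, t)).
split=> [[t h]|h].
  inversion h; subst; exists t; apply: contraT => nb.
  (* If [B] failed at [t], the program [p] would have both values 1 and 0 there; evaluated with a
     common fuel these must agree. *)
  have [F [cF mF eF]] := fueled_all p n.+1.
  have /(eF (x, t))[t1 e1] := ev t.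
  have /(eF (x, t))[t2 e2] : eval p (t :: env x) 0 by [].
  have := mF (x, t) t1 (maxn t1 t2) (leq_maxl _ _).
  have := mF (x, t) t2 (maxn t1 t2) (leq_maxr _ _).
  by rewrite e1 e2 nb => -> // /(_ isT).
have := ex_minnP h => -[t bt mt]; exists t; constructor.
  by have := ev t; rewrite bt.
move=> m mt'; exists 1; split=> //.
have := ev m; case E: (B (x, m)) => //.
by have := mt _ E; rewrite leqNgt mt'.
Qed.

(** * Codes of strings and stages of c.e. sets *)

Lemma code_inj : injective code.
Proof.
elim=> [|b s IH] [|b' s'] //= e; [lia | lia |].
have es : code s = code s' by case: b b' e => -[] /=; lia.
have eb : b = b' by case: b b' e => -[] //=; lia.
by rewrite eb (IH _ es).
Qed.

Lemma code_surj j : exists s, code s == j.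
Proof.
elim/ltn_ind: j => -[|j] IH; first by exists [::].
have [|s /eqP e] := IH j./2; first lia.
exists (odd j :: s); rewrite /= e; lia.
Qed.

(** The inverse is obtained by choice, so computability claims about decoded strings are reduced to
    arithmetic on codes. *)
Definition uncode (j : nat) : str := xchoose (code_surj j).

Lemma uncodeK : cancel uncode code.
Proof. by move=> j; exact/eqP/(xchooseP (code_surj j)). Qed.

Lemma codeK : cancel code uncode.
Proof. by move=> s; apply: code_inj; rewrite uncodeK. Qed.

Lemma code_size s : 2 ^ size s <= (code s).+1 < 2 ^ (size s).+1.
Proof. by elim: s => //= b s; rewrite !expnS; case: b => /=; lia. Qed.

Lemma size_le_code s : size s <= code s.
Proof. have := code_size s; have := ltn_expl (size s) (ltnSn 1); lia. Qed.

Lemma code_cat s u : code (s ++ u) = code s + 2 ^ size s * code u.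
Proof. by elim: s => [|b s IH] /=; rewrite ?mul1n // IH expnS; lia. Qed.

Lemma count_ltn k n : k <= n -> count (fun L => L < k) (iota 0 n) = k.
Proof.
move=> kn; rewrite -(subnKC kn) iotaD count_cat.
rewrite (eq_in_count (a2 := predT)); last by move=> i; rewrite mem_iota /= add0n => ->.
rewrite (eq_in_count (a2 := pred0) (s := iota _ (n - k))).
  by rewrite count_predT count_pred0 size_iota addn0.
by move=> i; rewrite mem_iota /= add0n => /andP[ki _]; rewrite ltnNge ki.
Qed.

(** By [code_size] the length is determined by the powers of 2 below the code plus one, hence is a
    bounded count; the bound [j] suffices since no string is longer than its code. *)
Lemma size_uncode j : size (uncode j) = count (fun L => 2 ^ L.+1 <= j.+1) (iota 0 j).
Proof.
rewrite -{2 3}(uncodeK j); set s := uncode j.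
rewrite -[LHS](count_ltn (size_le_code s)); apply: eq_count => L.
have /andP[h1 h2] := code_size s; apply/idP/idP => h.
  by apply: leq_trans h1; rewrite leq_exp2l.
by move: (leq_ltn_trans h h2); rewrite ltn_exp2l.
Qed.

Lemma cmp_size n f : cmp f -> cmp (fun x : ctx n => size (uncode (f x))).
Proof.
apply: (@cmp_comp1 (fun j => size (uncode j))).
apply: (@cmp_ext _ (fun y : ctx 1 => count (fun L => 2 ^ L.+1 <= y.2.+1) (iota 0 y.2))).
  by move=> y; rewrite size_uncode.
apply: (@cmp_count 1 (fun y L => 2 ^ L.+1 <= y.2.+1) (fun y => y.2)); last cvar.
apply: dec_leq; last by apply: cmp_succ; cvar.
by apply: cmp_exp; [exact: cmp_const | apply: cmp_succ; cvar].
Qed.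

(** Appending [u] to [s] adds [2 ^ size s * code u] to the code, and every number is a code; the
    search for the remainder stops at [code x]. *)
Lemma prefix_code s x :
  prefix s x = has (fun u => code s + 2 ^ size s * u == code x) (iota 0 (code x).+1).
Proof.
apply/prefixP/hasP => [[u ->]|[u _ /eqP e]].
  exists (code u); last by rewrite code_cat.
  rewrite mem_iota code_cat /= add0n ltnS.
  by apply: leq_trans (leq_addl _ _); rewrite leq_pmull // expn_gt0.
by exists (uncode u); apply: code_inj; rewrite code_cat uncodeK.
Qed.

Lemma dec_prefix n f g : cmp f -> cmp g ->
  dec (fun x : ctx n => prefix (uncode (f x)) (uncode (g x))).
Proof.
apply: (@cmp_comp2 (fun i j => prefix (uncode i) (uncode j))).
apply: (@cmp_ext _ (fun y : ctx 2 =>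
  has (fun u => y.1.2 + 2 ^ size (uncode y.1.2) * u == y.2) (iota 0 y.2.+1))).
  by move=> y; rewrite prefix_code !uncodeK.
apply: (@dec_has 2 (fun y u => y.1.2 + 2 ^ size (uncode y.1.2) * u == y.2)); last first.
  by apply: cmp_succ; cvar.
apply: dec_eq; last cvar.
apply: cmp_add; first cvar.
apply: cmp_mul; last cvar.
by apply: cmp_exp; [exact: cmp_const | apply: cmp_size; cvar].
Qed.

Fixpoint strings (N : nat) (x : str) : seq str :=
  if N is M.+1 then strings M (rcons x false) ++ strings M (rcons x true) else [:: x].

Lemma stringsP N x y : reflect (exists2 u, y = x ++ u & size u = N) (y \in strings N x).
Proof.
elim: N x y => [|N IH] x y /=.
  rewrite inE; apply: (iffP eqP) => [->|[[|b u] -> //]]; last by rewrite cats0.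
  by exists [::]; rewrite ?cats0.
rewrite mem_cat; apply: (iffP orP) => [[/IH|/IH] [u -> <-]|[[//|[] u]]].
- by exists (false :: u); rewrite ?cat_rcons.
- by exists (true :: u); rewrite ?cat_rcons.
- by move=> -> [e]; right; apply/IH; exists u; rewrite ?cat_rcons.
- by move=> -> [e]; left; apply/IH; exists u; rewrite ?cat_rcons.
Qed.

Lemma strings0P N y : (y \in strings N [::]) = (size y == N).
Proof. by apply/stringsP/eqP => [[u -> <-]|<-] //; exists y. Qed.

Lemma size_strings N x : size (strings N x) = 2 ^ N.
Proof. by elim: N x => //= N IH x; rewrite size_cat !IH expnS; lia. Qed.

Lemma uniq_strings N x : uniq (strings N x).
Proof.
elim: N x => //= N IH x; rewrite cat_uniq !IH andbT.
apply/hasPn => y /stringsP[u -> _]; apply/stringsP => -[v /eqP].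
by rewrite !cat_rcons eqseq_cat // eqxx /= eqseq_cons.
Qed.

Lemma cmp_count_strings n (P : ctx n -> str -> bool) F :
  dec (fun y : ctx n.+1 => P y.1 (uncode y.2)) -> cmp F ->
  cmp (fun x => count (P x) (strings (F x) [::])).
Proof.
move=> hP hF.
apply: (@cmp_ext _ (fun x => count
   (fun j => (size (uncode j) == F x) && P x (uncode j)) (iota 0 (2 ^ (F x).+1)))).
  move=> x; rewrite -[RHS]size_filter -(size_map code) -size_filter.
  apply/perm_size/uniq_perm; first by rewrite filter_uniq ?iota_uniq.
    by rewrite (map_inj_uniq code_inj) filter_uniq ?uniq_strings.
  move=> j; rewrite -(uncodeK j) (mem_map code_inj) !mem_filter !uncodeK strings0P mem_iota.
  rewrite andbC -andbA; case: eqP => //= e; rewrite ?andbF // andbT.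
  rewrite -e /=; move: (code_size (uncode j)); rewrite uncodeK => /andP[_ /ltnW h].
  by rewrite add0n h.
apply: (@cmp_count n (fun x j => (size (uncode j) == F x) && P x (uncode j))); last first.
  by apply: cmp_exp; [exact: cmp_const | exact: cmp_succ].
apply: dec_and => //; apply: dec_eq; last exact: cmp_weak.
by apply: cmp_size; cvar.
Qed.

(** * Uniformly c.e. families and their finite stages *)

Definition sigma1 (B : nat -> nat -> nat -> bool) (U : nat -> set str) : Prop :=
  dec (fun y : ctx 3 => B y.1.1.2 y.1.2 y.2) /\
  forall i s, U i s <-> exists t, B i (code s) t.

Lemma unif_ce_sigma1 U : unif_ce U -> exists B, sigma1 B U.
Proof.
move=> [f hf]; have [B dB hB] := halts_dec 2 f.
exists (fun i j t => B ((((tt, j), i), t) : ctx 3)); split=> [|i s]; last first.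
  by rewrite hf; exact: (hB (((tt, code s), i) : ctx 2)).
apply: (cmp_comp (m := 3) (W := fun y : ctx 3 => ((((tt, y.1.2), y.1.1.2), y.2) : ctx 3)) _ dB).
by do !apply: cmpv_cons; [exact: cmpv_nil | cvar | cvar | cvar].
Qed.

Lemma sigma1_unif_ce B U : sigma1 B U -> unif_ce U.
Proof.
move=> [dB hB].
have dB' : dec (fun y : ctx 3 => B y.1.2 y.1.1.2 y.2).
  apply: (cmp_comp (m := 3) (W := fun y : ctx 3 => ((((tt, y.1.2), y.1.1.2), y.2) : ctx 3)) _ dB).
  by do !apply: cmpv_cons; [exact: cmpv_nil | cvar | cvar | cvar].
have [f hf] := dec_halts dB'; exists f => i s; rewrite hB.
by have := hf (((tt, code s), i) : ctx 2) => /= ->.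
Qed.

(** Both unbounded witnesses are searched for below one common bound. *)
Lemma sigma1_ex2 (D : nat -> nat -> nat -> nat -> bool) U :
  dec (fun y : ctx 4 => D y.1.1.1.2 y.1.1.2 y.1.2 y.2) ->
  (forall i s, U i s <-> exists a b, D i (code s) a b) ->
  sigma1 (fun i j t => has (fun a => has (D i j a) (iota 0 t.+1)) (iota 0 t.+1)) U.
Proof.
move=> dD hD; split=> [|i s].
  apply: (@dec_has 3 (fun y a => has (D y.1.1.2 y.1.2 a) (iota 0 y.2.+1))
     (fun y => y.2.+1)); last by apply: cmp_succ; cvar.
  apply: (@dec_has 4 (fun y => D y.1.1.1.2 y.1.1.2 y.2) (fun y => y.1.2.+1)); last first.
    by apply: cmp_succ; cvar.
  apply: (cmp_comp (m := 4) (W := fun y : ctx 5 =>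
     (((((tt, y.1.1.1.1.2), y.1.1.1.2), y.1.2), y.2) : ctx 4)) _ dD).
  by do !apply: cmpv_cons; [exact: cmpv_nil | cvar | cvar | cvar | cvar].
rewrite hD; split=> [[a [b h]]|[t /hasP[a _ /hasP[b _ h]]]]; last by exists a, b.
exists (maxn a b); apply/hasP; exists a; first by rewrite mem_iota /= ltnS leq_maxl.
by apply/hasP; exists b => //; rewrite mem_iota /= ltnS leq_maxr.
Qed.

(** A clopen approximation of [cyl (U i)]: one number [N] bounds both the strings considered and
    their witnesses. It persists when [N] grows or [x] is extended. *)
Definition stage (B : nat -> nat -> nat -> bool) (i N : nat) (x : str) : bool :=
  has (fun z => prefix (uncode z) x && has (B i z) (iota 0 N.+1)) (iota 0 N.+1).

Lemma dec_stage B n (f g h : ctx n -> nat) :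
  dec (fun y : ctx 3 => B y.1.1.2 y.1.2 y.2) -> cmp f -> cmp g -> cmp h ->
  dec (fun x => stage B (f x) (g x) (uncode (h x))).
Proof.
move=> dB; apply: (@cmp_comp3 (fun i N x => stage B i N (uncode x))).
apply: (@dec_has 3
   (fun y z => prefix (uncode z) (uncode y.2) && has (B y.1.1.2 z) (iota 0 y.1.2.+1))
   (fun y => y.1.2.+1)); last by apply: cmp_succ; cvar.
apply: dec_and; first by apply: dec_prefix; cvar.
apply: (@dec_has 4 (fun y => B y.1.1.1.2 y.2) (fun y => y.1.1.2.+1)); last first.
  by apply: cmp_succ; cvar.
by apply: (@cmp_comp3 (fun i j t => nat_of_bool (B i j t))) => //; cvar.
Qed.

Lemma stageP (B : nat -> nat -> nat -> bool) i N x : reflect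
  (exists z t, [/\ code z <= N, t <= N, prefix z x & B i (code z) t]) (stage B i N x).
Proof.
apply: (iffP hasP) => [[j hj /andP[p] /hasP[t ht b]]|[z [t [h1 h2 h3 h4]]]].
  exists (uncode j), t; rewrite uncodeK; move: hj ht; rewrite !mem_iota /= !ltnS.
  by split.
exists (code z); first by rewrite mem_iota ltnS.
rewrite codeK h3; apply/hasP.
by exists t => //; rewrite mem_iota ltnS.
Qed.

Lemma stage_mono B i N M x y : N <= M -> prefix x y -> stage B i N x -> stage B i M y.
Proof.
move=> NM xy /stageP[z [t [h1 h2 h3 h4]]]; apply/stageP; exists z, t.
by split=> //; [exact: leq_trans NM | exact: leq_trans NM | exact: prefix_trans xy].
Qed.

Lemma pre_mkseq X N : pre (mkseq X N) X.
Proof. by move=> i; rewrite size_mkseq => h; rewrite nth_mkseq. Qed.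

Lemma prefix_pre s y X : prefix s y -> pre y X -> pre s X.
Proof.
move=> /prefixP[u ->] h i si; rewrite -h; first by rewrite nth_cat si.
by rewrite size_cat ltn_addr.
Qed.

Lemma pre_prefix s y X : pre s X -> pre y X -> size s <= size y -> prefix s y.
Proof.
move=> hs hy h; rewrite prefixE; apply/eqP/(@eq_from_nth _ false).
  by rewrite size_takel.
move=> i; rewrite size_takel // => si; rewrite nth_take // hs // hy //.
exact: leq_trans h.
Qed.

Lemma mkseq_pre s X : pre s X -> mkseq X (size s) = s.
Proof.
move=> h; apply/(@eq_from_nth _ false); first by rewrite size_mkseq.
by move=> i; rewrite size_mkseq => si; rewrite nth_mkseq // h.
Qed.

Lemma sigma1_cyl B U i X : sigma1 B U ->
  cyl (U i) X <-> exists N, stage B i N (mkseq X N).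
Proof.
move=> [_ hB]; split=> [[s /hB[t b] p]|[N /stageP[z [t [h1 h2 h3 h4]]]]]; last first.
  by exists z; [apply/hB; exists t | exact: prefix_pre h3 (@pre_mkseq _ _)].
(* As a string is no longer than its code, the prefix of [X] of this length already extends [s]. *)
exists (maxn (code s) t); apply/stageP; exists s, t.
split; rewrite ?leq_maxl ?leq_maxr //.
apply: (pre_prefix p (@pre_mkseq _ _)); rewrite size_mkseq.
exact: leq_trans (size_le_code s) (leq_maxl _ _).
Qed.

Lemma stage_cyl B U i N x X : sigma1 B U -> pre x X -> stage B i N x -> cyl (U i) X.
Proof.
move=> [_ hB] p /stageP[z [t [h1 h2 h3 h4]]].
by exists z; [apply/hB; exists t | exact: prefix_pre p].
Qed.

Local Open Scope ring_scope.

(** * Density of open sets *)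

Definition isopen (C : set cantor) : Prop :=
  forall X, C X -> exists n, forall Z, pre (mkseq X n) Z -> C Z.

Definition inside (C : set cantor) (x : str) : bool := `[< forall X, pre x X -> C X >].

Definition upclosed (P : pred str) : Prop := forall x y, prefix x y -> P x -> P y.

Lemma upclosed_inside C : upclosed (inside C).
Proof.
by move=> x y xy /asboolP h; apply/asboolP => X p; apply: h; exact: prefix_pre p.
Qed.

Lemma inside_sub C D x : C `<=` D -> inside C x -> inside D x.
Proof. by move=> CD /asboolP h; apply/asboolP => X /h /CD. Qed.

Lemma isopen_cyl S : isopen (cyl S).
Proof.
move=> X [s Ss p]; exists (size s) => Z; rewrite mkseq_pre // => q.
by exists s.
Qed.

Lemma isopenI C D : isopen C -> isopen D -> isopen (C `&` D).
Proof.
move=> oC oD X [/oC[n hn] /oD[m hm]]; exists (maxn n m) => Z p.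
split; [apply: hn|apply: hm]; apply: prefix_pre p;
  apply: pre_prefix (@pre_mkseq _ _) (@pre_mkseq _ _) _; rewrite !size_mkseq;
  [exact: leq_maxl | exact: leq_maxr].
Qed.

Lemma extend_pre (x : str) : exists X : cantor, pre x X.
Proof. by exists (nth false x). Qed.

Lemma all_strings_mono P N M x : upclosed P -> (N <= M)%N ->
  all P (strings N x) -> all P (strings M x).
Proof.
move=> upP; elim: N M x => [|N IH] [|M] x //=; last first.
  by rewrite ltnS => NM; rewrite !all_cat => /andP[h1 h2]; rewrite !(IH _ _ NM).
rewrite andbT => _ Px; rewrite all_cat; apply/andP.
by split; apply/allP => y /stringsP[u -> _]; apply: upP Px; rewrite cat_rcons; exact: prefix_prefix.
Qed.

(* A counterexample is a path through the nodes above which P fails at every level. *)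
Lemma compactness P x : upclosed P -> (forall X, pre x X -> exists n, P (mkseq X n)) ->
  exists N, all P (strings N x).
Proof.
move=> upP h; apply: contrapT => hx.
pose bad y := ~ exists N, all P (strings N y).
have step y : bad y -> bad (rcons y false) \/ bad (rcons y true).
  move=> b; apply: contrapT => /not_orP[/contrapT[N hN] /contrapT[M hM]].
  apply: b; exists (maxn N M).+1; rewrite /= all_cat.
  by rewrite (all_strings_mono upP (leq_maxl _ _) hN) (all_strings_mono upP (leq_maxr _ _) hM).
pose f y := rcons y (~~ `[< bad (rcons y false) >]).
have bf y : bad y -> bad (f y).
  by rewrite /f; case: asboolP => //= nb /step[].
pose z n := iter n f x.
have bz n : bad (z n) by elim: n => //= n; exact: bf.
have sz n : size (z n) = (size x + n)%N.
  by elim: n => [|n IH]; rewrite ?addn0 //= size_rcons IH addnS.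
have pz n m : (n <= m)%N -> prefix (z n) (z m).
  move/subnKC <-; elim: (m - n)%N => [|k IH]; first by rewrite addn0 prefix_refl.
  by rewrite addnS; apply: prefix_trans IH _; rewrite /= /f -cats1 prefix_prefix.
pose X : cantor := fun i => nth false (z i.+1) i.
have pX n : pre (z n) X.
  move=> i si; rewrite /X; case/orP: (leq_total n i.+1) => /pz /prefixP[u ->].
    by rewrite nth_cat si.
  by rewrite nth_cat sz; case: ltnP => //; lia.
have [n hn] := h X (pX 0).
apply: (bz n); exists 0; rewrite /= andbT; apply: upP hn.
by apply: pre_prefix (@pre_mkseq _ _) (pX n) _; rewrite size_mkseq sz leq_addl.
Qed.

(** The pointwise form of disjointness: summed over the strings of a level, it bounds the total
    density of disjoint sets by that of a set containing them. *)
Lemma sum_atmost1 (I : eqType) (l : seq I) (p : I -> bool) (q : bool) : uniq l ->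
  (forall s t, s \in l -> t \in l -> p s -> p t -> s = t) ->
  (forall s, s \in l -> p s -> q) -> (\sum_(s <- l) p s <= q)%N.
Proof.
elim: l => [|a l IH] /=; first by rewrite big_nil.
move=> /andP[al ul] h1 h2; rewrite big_cons.
case pa: (p a); last first.
  rewrite add0n; apply: IH => // [s t sl tl|s sl]; first by apply: h1; rewrite inE ?sl ?tl orbT.
  by apply: h2; rewrite inE sl orbT.
rewrite (h2 a) ?mem_head // big_seq big1 // => s sl.
apply/eqP; rewrite eqb0; apply/negP => ps.
by move: al; rewrite (h1 a s) ?sl ?mem_head // inE sl orbT.
Qed.

Section Density.
Variable R : realType.
Implicit Types (P Q : pred str) (C D : set cantor) (N M : nat).

Definition frac P N : R := (count P (strings N [::]))%:R / 2 ^+ N.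
(** The measure of the union of the cylinders of level [N] inside [C]. It increases with [N], and
    for open [C] its supremum is the measure of [C]; bounds on measures are therefore stated as
    bounds for all [N]. *)
Definition dens C N : R := frac (inside C) N.

Lemma pow2_gt0 N : 0 < (2 : R) ^+ N. Proof. by rewrite exprn_gt0. Qed.
Hint Resolve pow2_gt0 : core.

Lemma frac_ge0 P N : 0 <= frac P N.
Proof. by rewrite divr_ge0 // ltW. Qed.

Lemma frac_le P Q N : (forall x, size x = N -> P x -> Q x) -> frac P N <= frac Q N.
Proof.
move=> h; rewrite ler_pM2r ?invr_gt0 // ler_nat -!size_filter.
apply: uniq_leq_size; first by rewrite filter_uniq ?uniq_strings.
move=> x; rewrite !mem_filter strings0P => /andP[px /eqP sx].
by rewrite h // sx eqxx.
Qed.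

Lemma sub_dens C D N : C `<=` D -> dens C N <= dens D N.
Proof. by move=> CD; apply: frac_le => x _; exact: inside_sub. Qed.

(** From one level to the next the denominator doubles and the count at least doubles, as both
    one-bit extensions of a string in [P] are in [P]. *)
Lemma frac_mono P N M : upclosed P -> (N <= M)%N -> frac P N <= frac P M.
Proof.
move=> upP; move/subnKC <-; elim: (M - N)%N => [|k IH]; first by rewrite addn0.
apply: le_trans IH _; rewrite addnS; move: (N + k)%N => n.
rewrite /frac ler_pdivrMr // exprS invfM mulrA mulfVK ?gt_eqF //.
rewrite ler_pdivlMr // -natrM ler_nat; move: [::] => x.
elim: n x => [|n IH] x; last first.
  have stringsS m : strings m.+1 x = strings m (rcons x false) ++ strings m (rcons x true).
    by [].
  rewrite [strings n.+1 x]stringsS [strings n.+2 x]stringsS.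
  rewrite (count_cat _ (strings n _)) (count_cat _ (strings n.+1 _)) mulnDl.
  exact: leq_add (IH _) (IH _).
rewrite /=; case Px: (P x) => //.
have e b : P (rcons x b) by apply: upP Px; rewrite -cats1 prefix_prefix.
by rewrite !e.
Qed.

Lemma dens_mono C N M : (N <= M)%N -> dens C N <= dens C M.
Proof. by apply: frac_mono; exact: upclosed_inside. Qed.

Lemma fracE P N : frac P N = (\sum_(x <- strings N [::]) (P x)%:R) / 2 ^+ N.
Proof.
by rewrite /frac -sum1_count big_mkcond natr_sum; congr (_ / _).
Qed.

Lemma sum_frac_le (I : Type) (l : seq I) (P : I -> pred str) Q N :
  (forall x, size x = N -> (\sum_(i <- l) P i x <= Q x)%N) ->
  \sum_(i <- l) frac (P i) N <= frac Q N.
Proof.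
move=> h; under eq_bigr do rewrite fracE.
rewrite -mulr_suml fracE ler_pM2r ?invr_gt0 // exchange_big /=.
rewrite big_seq [leRHS]big_seq; apply: ler_sum => x; rewrite strings0P => /eqP /h.
by rewrite -natr_sum ler_nat.
Qed.

Lemma frac_le_sum (I : Type) (l : seq I) (P : I -> pred str) Q N :
  (forall x, size x = N -> (Q x <= \sum_(i <- l) P i x)%N) ->
  frac Q N <= \sum_(i <- l) frac (P i) N.
Proof.
move=> h; under [leRHS]eq_bigr do rewrite fracE.
rewrite -mulr_suml fracE ler_pM2r ?invr_gt0 // exchange_big /=.
rewrite big_seq [leRHS]big_seq; apply: ler_sum => x; rewrite strings0P => /eqP /h.
by rewrite -natr_sum ler_nat.
Qed.

Lemma frac_prefix s N : (size s <= N)%N -> frac (prefix s) N = 2 ^- size s.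
Proof.
move=> sN; rewrite /frac -size_filter.
have -> : size [seq x <- strings N [::] | prefix s x] = size (strings (N - size s) s).
  apply/perm_size/uniq_perm; rewrite ?filter_uniq ?uniq_strings // => x.
  rewrite mem_filter strings0P; apply/andP/stringsP => [[/prefixP[u ->] /eqP e]|[u -> e]].
    by exists u => //; rewrite -e size_cat addKn.
  by rewrite prefix_prefix size_cat e subnKC.
rewrite size_strings natrX expfB_cond ?pnatr_eq0 //.
by rewrite mulrAC mulfV ?mul1r // gt_eqF.
Qed.

Lemma frac_prefix_le s N : frac (prefix s) N <= 2 ^- size s.
Proof.
case: (leqP (size s) N) => [/frac_prefix-> //|h].
rewrite /frac (eq_in_count (a2 := pred0)).
  by rewrite count_pred0 mul0r invr_ge0 ltW.
move=> x; rewrite strings0P => /eqP sx /=; apply/negP => /size_prefix; lia.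
Qed.

(** Finitely many cylinders of level [N] lie inside [C]; [compactness] gives each of them a finite
    level at which [P] holds throughout, and the largest serves all. In this way stages of an
    enumeration exhaust the measure. *)
Lemma dens_compact C P N : upclosed P -> (forall X, C X -> exists n, P (mkseq X n)) ->
  exists2 M, (N <= M)%N & dens C N <= frac P M.
Proof.
move=> upP h.
have [K hK] : exists K, forall x, x \in strings N [::] -> inside C x -> all P (strings K x).
  elim: (strings N _) => [|x l [K hK]]; first by exists 0.
  case Cx: (inside C x); last first.
    exists K => y; rewrite inE => /orP[/eqP->|]; [by rewrite Cx | exact: hK].
  have [M hM] : exists M, all P (strings M x).
    by apply: compactness => // X p; apply: h; move/asboolP: Cx; apply.
  exists (maxn M K) => y; rewrite inE => /orP[/eqP-> _|yl Cy].
    exact: all_strings_mono (leq_maxl _ _) hM.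
  exact: all_strings_mono (leq_maxr _ _) (hK _ yl Cy).
exists (N + K)%N; first exact: leq_addr.
rewrite /dens /frac exprD invfM mulrA [leRHS]mulrAC ler_pM2r ?invr_gt0 //.
rewrite ler_pdivlMr // -natrX -natrM ler_nat.
move: hK; move: [::] => x; elim: N x => [|N IH] x hK /=.
  case Cx: (inside C x) => //=; rewrite addn0 mul1n.
  by have := hK x (mem_head _ _) Cx; rewrite all_count size_strings add0n => /eqP->.
rewrite !count_cat mulnDl; apply: leq_add; apply: IH => y hy; apply: hK => /=;
  by rewrite mem_cat hy ?orbT.
Qed.

(** Countable subadditivity for open sets: by compactness only finitely many of the [C j] matter at
    a given level. *)
Lemma dens_bigcup (C : nat -> set cantor) (r : nat -> R) (t : R) :
  (forall j, isopen (C j)) -> (forall j N, dens (C j) N <= r j) ->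
  (forall K, \sum_(j <- iota 0 K) r j <= t) ->
  forall N, dens [set X | exists j, C j X] N <= t.
Proof.
move=> oC hC hr N.
(* Bounding the index by the length makes [P] a finite union at each level and keeps it upward
   closed. *)
pose P y := has (fun j => inside (C j) y) (iota 0 (size y).+1).
have [|X [j /[dup] CX /oC[n hn]]|M NM hM] := @dens_compact [set X | exists j, C j X] P N.
- move=> x y xy /hasP[j hj jx]; apply/hasP; exists j; last exact: upclosed_inside jx.
  by move: hj; rewrite !mem_iota /= !add0n !ltnS => /leq_trans; apply; exact: size_prefix.
- exists (maxn n j); apply/hasP; exists j.
    by rewrite mem_iota size_mkseq /= ltnS leq_maxr.
  apply/asboolP => Z p; apply: hn; apply: prefix_pre p.
  by apply: pre_prefix (@pre_mkseq _ _) (@pre_mkseq _ _) _; rewrite !size_mkseq leq_maxl.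
apply: le_trans hM _; apply: le_trans (hr M.+1).
apply: le_trans (_ : \sum_(j <- iota 0 M.+1) dens (C j) M <= _); last first.
  by apply: ler_sum => j _.
apply: frac_le_sum => x sx; rewrite /P sx; case: hasP => // -[j hj jx].
by rewrite (big_rem j) //= jx.
Qed.

Lemma dens_cyl_le (S : set str) (r : R) :
  (forall l, uniq l -> (forall s, s \in l -> S s) -> \sum_(s <- l) 2 ^- size s <= r) ->
  forall N, dens (cyl S) N <= r.
Proof.
move=> h N; pose P y := `[< exists2 s, S s & prefix s y >].
have [|X [s Ss p]|M NM hM] := @dens_compact (cyl S) P N.
- by move=> x y xy /asboolP[s Ss sx]; apply/asboolP; exists s => //; exact: prefix_trans xy.
- by exists (size s); apply/asboolP; exists s; rewrite ?mkseq_pre ?prefix_refl.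
(* Strings of length at most [M] have codes below [2 ^ M.+1], so [l] contains every member of [S]
   that is a prefix of a string of level [M]. *)
pose l := [seq s <- [seq uncode z | z <- iota 0 (2 ^ M.+1)] | `[< S s >]].
apply: le_trans hM _; apply: le_trans (h l _ _).
- apply: le_trans (_ : \sum_(s <- l) frac (prefix s) M <= _); last first.
    by apply: ler_sum => s _; exact: frac_prefix_le.
  apply: frac_le_sum => x sx; rewrite /P; case: asboolP => // -[s Ss px].
  suff sl : s \in l by rewrite (big_rem s) //= px.
  rewrite mem_filter asboolT //=; apply/mapP; exists (code s); last by rewrite codeK.
  rewrite mem_iota /= add0n.
  have /andP[_ h1] := code_size s; apply: leq_trans (ltnW h1) _.
  by rewrite leq_exp2l // ltnS -sx size_prefix.
- by rewrite filter_uniq // map_inj_uniq ?iota_uniq //; exact: can_inj uncodeK.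
- by move=> s; rewrite mem_filter => /andP[/asboolP].
Qed.

Lemma dens_le_lam A N : ((dens A N)%:E <= @lam R A)%E.
Proof.
apply: le_ereal_inf_tmp => _ [S AS <-].
case E : (esum _ _) => [r| |]; last 2 first.
- exact: leey.
- have := @esum_ge0 R _ S (fun s : str => (2 ^- size s)%:E).
  by rewrite E => /(_ _)/wrap[] // s _; rewrite lee_fin invr_ge0 ltW.
rewrite lee_fin; apply: le_trans (sub_dens N AS) (dens_cyl_le _ N) => l ul lS.
rewrite -lee_fin -E; apply: esum_ge; exists [set` l].
  by split; [exact: finite_seq | move=> s /= /lS].
by rewrite -fsbig_seq // sumEFin.
Qed.

(** The minimal strings whose cylinder lies in [A] cover [A] by openness and form an antichain;
    finitely many of them have total weight at most the density of [A] at a level no smaller than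
    their lengths. *)
Lemma lam_le A r : isopen A -> (forall N, dens A N <= r) -> (@lam R A <= r%:E)%E.
Proof.
move=> oA h.
pose S := [set s : str | inside A s /\ forall k, (k < size s)%N -> ~~ inside A (take k s)].
apply: ge_ereal_inf; exists (esum S (fun s : str => (2 ^- size s)%:E)).
  exists S => // X AX.
  have ex : exists n, inside A (mkseq X n).
    by have [n hn] := oA _ AX; exists n; apply/asboolP.
  have := ex_minnP ex => -[n hn mn]; exists (mkseq X n); last exact: pre_mkseq.
  split=> // k; rewrite size_mkseq => kn; apply/negP => hk.
  suff /mn : inside A (mkseq X k) by rewrite leqNgt kn.
  by move: hk; rewrite /mkseq -map_take take_iota (minn_idPl (ltnW kn)).
apply: ge_ereal_sup => _ [F [finF FS] <-].
rewrite fsbig_finite // sumEFin lee_fin.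
have lS s : s \in enum_fset (fset_set F) -> S s.
  by move=> sF; apply: FS; have : s \in fset_set F by []; rewrite in_fset_set // => /set_mem.
have : uniq (fset_set F) by exact: fset_uniq.
move: (enum_fset (fset_set F)) lS => l lS ul.
pose M := \max_(s <- l) size s.
rewrite big_seq; under eq_bigr => s sl.
  rewrite -(@frac_prefix s M); first over.
  exact: leq_bigmax_seq.
rewrite -big_seq; apply: le_trans (h M); apply: sum_frac_le => x sx.
apply: sum_atmost1 => // [s t sl tl|s sl px]; last by apply: upclosed_inside px _; case: (lS s sl).
wlog st : s t sl tl / (size s <= size t)%N.
  by move=> w; case/orP: (leq_total (size s) (size t)) => h1 p1 p2; [|symmetry]; apply: w.
move=> /prefixP[u ex] /prefixP[v ex'].
have [_ ht] := lS t tl; have [hs _] := lS s sl.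
have es : s = take (size s) t.
  have := congr1 (take (size s)) ex; rewrite ex' [RHS]take_size_cat // take_cat.
  by case: ltngtP st => // e _; rewrite e subnn take0 cats0 take_size.
move: st; rewrite leq_eqVlt => /orP[/eqP e|/ht]; first by rewrite es e take_size.
by rewrite -es hs.
Qed.

End Density.

(** * Small parts of the sets A s *)

Lemma stage_mkseq (B : nat -> nat -> nat -> bool) i N M x X :
  stage B i N x -> pre x X -> (N <= M)%N -> stage B i M (mkseq X M).
Proof.
move=> /stageP[z [t [h1 h2 h3 h4]]] p NM; apply/stageP; exists z, t.
have zM := leq_trans h1 NM; split=> //; first exact: leq_trans NM.
apply: pre_prefix (prefix_pre h3 p) (@pre_mkseq _ _) _.
by rewrite size_mkseq; exact: leq_trans (size_le_code _) zM.
Qed.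

Lemma upclosed_stage (B : nat -> nat -> nat -> bool) i N : upclosed (stage B i N).
Proof. by move=> x y; exact: stage_mono. Qed.

Lemma upclosed_stage_size (B : nat -> nat -> nat -> bool) i :
  upclosed (fun y => stage B i (size y) y).
Proof. by move=> x y xy; apply: stage_mono => //; exact: size_prefix. Qed.

Lemma pow2_unbounded (R : realType) (x : R) : exists N, forall M, (N <= M)%N -> x < 2 ^+ M.
Proof.
exists (Num.bound `|x|) => M h; apply: le_lt_trans (ler_norm x) _.
apply: lt_le_trans (archi_boundP (normr_ge0 x)) _.
rewrite -natrX ler_nat; apply: leq_trans h _; exact/ltnW/ltn_expl.
Qed.

Lemma common_bound (I : eqType) (l : seq I) (P : I -> nat -> Prop) :
  (forall i N M, (N <= M)%N -> P i N -> P i M) ->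
  (forall i, i \in l -> exists N, P i N) -> exists N, forall i, i \in l -> P i N.
Proof.
move=> mono; elim: l => [|i l IH] h; first by exists 0.
have [N hN] := h i (mem_head _ _).
have [|M hM] := IH; first by move=> j jl; apply: h; rewrite inE jl orbT.
exists (maxn N M) => j; rewrite inE => /orP[/eqP->|/hM].
  exact: mono (leq_maxl _ _) hN.
exact: mono (leq_maxr _ _).
Qed.

Lemma dens_set0 (R : realType) N : dens R set0 N = 0.
Proof.
rewrite /dens /frac (eq_count (a2 := pred0)) ?count_pred0 ?mul0r //.
by move=> x /=; apply/negP => /asboolP h; have [X /h] := extend_pre x.
Qed.

Lemma prefix_size (s t : str) : prefix s t -> (size t <= size s)%N -> s = t.
Proof. by rewrite prefixE => /eqP {2}<- h; rewrite take_oversize. Qed.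

Lemma code_prefix_lt s t : prefix s t -> s != t -> (code s < code t)%N.
Proof.
move=> /prefixP[[|b u] ->]; first by rewrite cats0 eqxx.
by move=> _; rewrite code_cat -[X in (X < _)%N]addn0 ltn_add2l muln_gt0 expn_gt0 /= addn1.
Qed.

Section Core.
Variables (R : realType) (A : str -> set cantor) (G : nat -> set str).
Variables (BA : nat -> nat -> nat -> bool) (rho : str -> R) (a b : nat -> nat -> nat).
Hypothesis AE : forall s, A s = cyl (G (code s)).
Hypothesis sA : sigma1 BA G.
Hypothesis A_sub : forall s t, prefix s t -> A t `<=` A s.
Hypothesis A_comp : forall s t X, A s X -> A t X -> prefix s t || prefix t s.
(** Together with [rho_lub] this makes [rho s] the supremum of the densities of [A s], that is, its
    measure. *)
Hypothesis rho_ub : forall s N, dens R (A s) N <= rho s.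
Hypothesis rho_lub : forall s r, (forall N, dens R (A s) N <= r) -> rho s <= r.
Hypothesis ca : cmp (fun y : ctx 2 => a y.1.2 y.2).
Hypothesis cb : cmp (fun y : ctx 2 => b y.1.2 y.2).
Hypothesis abP : forall s N,
  `|rho s - ((a (code s) N)%:R - (b (code s) N)%:R) / 2 ^+ N| <= 2 ^- N.

Lemma isopen_A s : isopen (A s).
Proof. by rewrite AE; exact: isopen_cyl. Qed.

Lemma abP_scaled s N :
  `|2 ^+ N * rho s - ((a (code s) N)%:R - (b (code s) N)%:R)| <= 1.
Proof.
have V : 0 < (2 : R) ^+ N by exact: pow2_gt0.
have := abP s N; set d := (a _ _)%:R - _ => h.
have -> : 2 ^+ N * rho s - d = 2 ^+ N * (rho s - d / 2 ^+ N) by field; rewrite gt_eqF.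
by rewrite normrM gtr0_norm // -ler_pdivlMl // mulr1.
Qed.

(** A sum of suprema of increasing sequences is the supremum of the sums: different levels are
    replaced by their maximum. *)
Lemma sum_rho_le (l : seq str) (r : R) :
  (forall N, \sum_(s <- l) dens R (A s) N <= r) -> \sum_(s <- l) rho s <= r.
Proof.
elim: l r => [|s l IH] r h; first by have := h 0; rewrite !big_nil.
rewrite big_cons -lerBrDr; apply: rho_lub => N; rewrite lerBrDl -lerBrDr.
apply: IH => M; rewrite lerBrDr addrC.
apply: le_trans (h (maxn N M)); rewrite big_cons; apply: lerD.
  exact: dens_mono (leq_maxl _ _).
by apply: ler_sum => t _; exact: dens_mono (leq_maxr _ _).
Qed.

(** By [A_comp] a point lies in [A s] for at most one member [s] of an antichain. *)
Lemma sum_dens_antichain (l : seq str) (C : set cantor) N : uniq l ->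
  (forall s t, s \in l -> t \in l -> prefix s t -> s = t) ->
  \sum_(s <- l) dens R (C `&` A s) N <= dens R C N.
Proof.
move=> ul anti; apply: sum_frac_le => x _; apply: sum_atmost1 => //.
  move=> s t sl tl /asboolP hs /asboolP ht; have [X pX] := extend_pre x.
  have [_ As] := hs _ pX; have [_ At] := ht _ pX.
  by case/orP: (A_comp As At) => p; [|symmetry]; apply: anti.
by move=> s _; apply: inside_sub => X [].
Qed.

Lemma sum_rho_antichain (l : seq str) (C : set cantor) (r : R) : uniq l ->
  (forall s t, s \in l -> t \in l -> prefix s t -> s = t) ->
  (forall s, s \in l -> A s `<=` C) -> (forall N, dens R C N <= r) ->
  \sum_(s <- l) rho s <= r.
Proof.
move=> ul anti lC hC; apply: sum_rho_le => N; apply: le_trans (hC N).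
apply: le_trans (sum_dens_antichain C N ul anti).
rewrite big_seq [leRHS]big_seq; apply: ler_sum => s sl.
by apply: sub_dens => X AX; split=> //; exact: lC AX.
Qed.

(** * Strings [s] on which a test covers too much of [A s] *)

Section Bounded.
Variables (O : nat -> set str) (BO : nat -> nat -> nat -> bool) (k : nat) (Y : cantor).
Hypothesis sO : sigma1 BO O.
Hypothesis O_le : forall c N, dens R (cyl (O c)) N <= 2 ^- c.
Hypothesis mlrY : MLR_rho rho Y.

(* The inequality [rho s < 2 ^ k * density] at level N, multiplied by [2 ^ N]; the extra 1 absorbs
   the error of the approximation of rho. *)
Let heavy c j N := (a j N + 1 <
  2 ^ k * count (fun x => stage BO c N x && stage BA j N x) (strings N [::]) + b j N)%N.
Let T c : set str := [set s | exists N, heavy c (code s) N].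

Lemma heavy_dec : dec (fun y : ctx 3 => heavy y.1.1.2 y.1.2 y.2).
Proof.
rewrite /heavy; under eq_fun do rewrite -addnS.
apply: dec_leq.
  by apply: cmp_add; [apply: (cmp_comp2 ca); cvar | exact: cmp_const].
apply: cmp_add; last by apply: (cmp_comp2 cb); cvar.
apply: cmp_mul; first exact: cmp_const.
apply: (@cmp_count_strings 3 (fun y x => stage BO y.1.1.2 y.2 x && stage BA y.1.2 y.2 x)
  (fun y => y.2)); last by cvar.
by apply: dec_and; apply: dec_stage; [exact: sO.1 | cvar | cvar | cvar
  | exact: sA.1 | cvar | cvar | cvar].
Qed.

Lemma heavy_sound c s N : heavy c (code s) N ->
  rho s < 2 ^+ k * dens R (cyl (O c) `&` A s) N.
Proof.
rewrite /heavy; set n := count _ _ => h.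
have V : 0 < (2 : R) ^+ N by exact: pow2_gt0.
have hf : n%:R / 2 ^+ N <= dens R (cyl (O c) `&` A s) N.
  apply: frac_le => x _ /andP[h1 h2]; apply/asboolP => X p; split.
    exact: stage_cyl sO p h1.
  by rewrite AE; exact: stage_cyl sA p h2.
have K : 0 < (2 : R) ^+ k by exact: pow2_gt0.
apply: lt_le_trans (_ : 2 ^+ k * (n%:R / 2 ^+ N) <= _); last by rewrite ler_pM2l.
rewrite mulrA ltr_pdivlMr // mulrC.
move: h; rewrite -(ltr_nat R) !natrD natrM natrX => h.
have := abP_scaled s N; rewrite ler_norml => /andP[_ h']; lra.
Qed.

Lemma heavy_complete c s N : rho s < 2 ^+ k * dens R (cyl (O c) `&` A s) N -> T c s.
Proof.
move=> h; pose P y := stage BO c (size y) y && stage BA (code s) (size y) y.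
have upP : upclosed P.
  by move=> x y xy /andP[h1 h2]; rewrite /P (upclosed_stage_size xy h1) (upclosed_stage_size xy h2).
have [X []|M NM hM] := @dens_compact R (cyl (O c) `&` A s) P N upP.
  move=> /(sigma1_cyl _ _ sO)[n hn]; rewrite AE => /(sigma1_cyl _ _ sA)[m hm].
  exists (maxn n m); rewrite /P size_mkseq.
  rewrite (stage_mkseq hn (@pre_mkseq _ _)) ?leq_maxl //.
  by rewrite (stage_mkseq hm (@pre_mkseq _ _)) ?leq_maxr.
set d := dens _ _ _ in h hM.
pose e := 2 ^+ k * d - rho s; have e0 : 0 < e by rewrite subr_gt0.
(* The 2 pays for the error 1 of the scaled approximation of [rho s] and for the extra 1 in [heavy];
   the scaled gap [2 ^ m * e] must exceed it. *)
have [L hL] := pow2_unbounded (2 / e).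
pose m := maxn M L; exists m.
have V : 0 < (2 : R) ^+ m by exact: pow2_gt0.
have K : 0 < (2 : R) ^+ k by exact: pow2_gt0.
rewrite /heavy -(ltr_nat R) !natrD natrM natrX; set n := count _ _.
have hn : d * 2 ^+ m <= n%:R.
  rewrite -ler_pdivlMr //; apply: le_trans hM _.
  apply: le_trans (frac_mono R upP (leq_maxl M L)) _.
  by apply: frac_le => x sx; rewrite /P sx.
have he : 2 < 2 ^+ m * e by rewrite -ltr_pdivrMr // hL // leq_maxr.
have := abP_scaled s m; rewrite ler_norml => /andP[h' _].
have : 2 ^+ k * (d * 2 ^+ m) <= 2 ^+ k * n%:R by rewrite ler_pM2l.
move: he; rewrite /e; move: (a _ _)%:R (b _ _)%:R h' => u v; nra.
Qed.

(* A heavy prefix must be recognized within [size s] steps: this makes the condition decidable, so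
   that its minimal solutions, an antichain, are again enumerable. *)
Let first_heavy c s : bool := stage heavy c (size s) s &&
  ~~ has (fun z => prefix (uncode z) s && stage heavy c (size (uncode z)) (uncode z))
    (iota 0 (code s)).
(** The shift of the index by [k] cancels the factor [2 ^ k] in [dens_heavy_le]. *)
Let E i : set str := [set s | first_heavy (i + k) s].

Lemma E_sigma1 : sigma1 (fun i j _ => first_heavy (i + k) (uncode j)) E.
Proof.
split; last by move=> i s; rewrite codeK; split=> [h|[]//]; exists 0.
have ci n (f : ctx n -> nat) : cmp f -> cmp (fun x => f x + k)%N.
  by move=> ?; apply: cmp_add => //; exact: cmp_const.
apply: dec_and.
  apply: (dec_stage heavy_dec); [by apply: ci; cvar | apply: cmp_size; cvar | cvar].
apply: dec_neg.
apply: (@dec_has 3 (fun y z => prefix (uncode z) (uncode y.1.2) &&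
    stage heavy (y.1.1.2 + k) (size (uncode z)) (uncode z))
  (fun y => code (uncode y.1.2))); last first.
  by apply: (@cmp_ext _ (fun y : ctx 3 => y.1.2)); [move=> y; rewrite uncodeK | cvar].
apply: dec_and; first by apply: dec_prefix; cvar.
by apply: (dec_stage heavy_dec); [by apply: ci; cvar | apply: cmp_size; cvar | cvar].
Qed.

Lemma first_heavy_antichain c s t :
  first_heavy c s -> first_heavy c t -> prefix s t -> s = t.
Proof.
move=> /andP[hs _] /andP[_ /hasPn ht] p; apply/eqP; apply: contraT => ne.
have := ht (code s); rewrite mem_iota /= add0n => /(_ (code_prefix_lt p ne)).
by rewrite codeK p hs.
Qed.

(* The union of the A s over the heavy s is covered by the antichain of minimal heavy s. *)
Lemma dens_heavy_le c N :
  dens R [set X | exists s, T c s /\ A s X] N <= 2 ^+ k / 2 ^+ c.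
Proof.
pose F s := T c s /\ forall t, prefix t s -> T c t -> t = s.
pose C j : set cantor := [set X | F (uncode j) /\ A (uncode j) X].
apply: le_trans (_ : dens R [set X | exists j, C j X] N <= _).
  apply: sub_dens => X [s [Ts As]].
  pose p n := `[< T c (take n s) >].
  have ex : exists n, p n by exists (size s); apply/asboolP; rewrite take_size.
  have := ex_minnP ex => -[n /asboolP hn mn]; exists (code (take n s)).
  rewrite /C /= codeK; split; last by apply: A_sub As; exact: prefix_take.
  split=> // t pt Tt; apply/prefix_size => //.
  have /mn : p (size t).
    apply/asboolP; suff -> : take (size t) s = t by [].
    by apply/eqP; rewrite -prefixE; apply: prefix_trans pt _; exact: prefix_take.
  by move=> h; rewrite size_take; case: ifP => // /negbT; rewrite -leqNgt => /leq_trans; apply.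
pose r j := if `[< F (uncode j) >] then rho (uncode j) else 0.
apply: (dens_bigcup (r := r)).
- move=> j X [Fj /isopen_A[n hn]]; exists n => Z /hn; by split.
- move=> j M; rewrite /r; case: asboolP => Fj.
    by apply: le_trans (rho_ub _ M); apply: sub_dens => X [].
  by rewrite (_ : C j = set0) ?dens_set0 //; apply/seteqP; split=> X [].
move=> K; rewrite -big_mkcond /= -big_filter.
rewrite -(big_map uncode xpredT rho).
set l := map _ _.
have ul : uniq l by rewrite map_inj_uniq ?filter_uniq ?iota_uniq //; exact: can_inj uncodeK.
have lF s : s \in l -> F s by move=> /mapP[j + ->]; rewrite mem_filter => /andP[/asboolP].
(* A single level at which the density inequality holds for all members of the finite list; it
   persists, as densities grow with the level. *)
have [|s /lF[[M hM] _]|M hM] := @common_bound _ l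
    (fun s M => rho s <= 2 ^+ k * dens R (cyl (O c) `&` A s) M).
- move=> s M M' MM' h; apply: le_trans h _.
  by rewrite ler_pM2l ?pow2_gt0 // dens_mono.
- by exists M; apply/ltW/heavy_sound.
apply: le_trans (_ : \sum_(s <- l) 2 ^+ k * dens R (cyl (O c) `&` A s) M <= _).
  by rewrite big_seq [leRHS]big_seq; exact: ler_sum.
rewrite -mulr_sumr ler_pM2l ?pow2_gt0 //.
apply: le_trans (O_le c M); apply: sum_dens_antichain => // s t /lF[Ts _] /lF[_ h] p.
exact: h.
Qed.

Lemma E_test : ML_test rho E.
Proof.
split; first exact: sigma1_unif_ce E_sigma1.
move=> i l ul lE.
have -> : (2 : R) ^- i = 2 ^+ k / 2 ^+ (i + k).
  by rewrite exprD invfM mulrCA mulfV ?mulr1 // gt_eqF ?pow2_gt0.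
apply: sum_rho_antichain (dens_heavy_le (i + k)) => //.
  by move=> s t /lE hs /lE ht; exact: first_heavy_antichain hs ht.
move=> s /lE /andP[/stageP[z [t [_ _ p h]]] _] X AX.
by exists z; split; [exists t | exact: A_sub p _ AX].
Qed.

(** Otherwise, for every [i], the component of [O] with index [i + k] is too large on some prefix of
    [Y]; then [E i] contains a prefix of [Y], against the randomness of [Y]. *)
Lemma bounded_level : exists c, forall n N,
  dens R (cyl (O c) `&` A (mkseq Y n)) N <= 2 ^- k * rho (mkseq Y n).
Proof.
apply: contrapT => /forallNP nh; apply: (mlrY E_test) => i.
have /existsNP[n /existsNP[N /negP]] := nh (i + k)%N.
rewrite -ltNge mulrC ltr_pdivrMr ?pow2_gt0 // mulrC => /heavy_complete[t ht].
pose m := maxn (code (mkseq Y n)) t.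
(* A longer prefix leaves enough time to recognize the heavy one; the shortest prefix of this kind
   is the member of [E i]. *)
have ex : exists m, stage heavy (i + k) m (mkseq Y m).
  exists m; apply/stageP; exists (mkseq Y n), t; split; rewrite ?leq_maxl ?leq_maxr //.
  apply: pre_prefix (@pre_mkseq _ _) (@pre_mkseq _ _) _; rewrite size_mkseq.
  by rewrite size_mkseq; apply: leq_trans (leq_maxl _ _); rewrite -{1}(size_mkseq Y n) size_le_code.
have := ex_minnP ex => -[q hq mq]; exists (mkseq Y q); last exact: pre_mkseq.
rewrite /E /= /first_heavy size_mkseq hq /=. apply/hasPn => z.
rewrite mem_iota /= add0n => zq; apply/negP => /andP[p hz].
have e := mkseq_pre (prefix_pre p (@pre_mkseq Y q)).
move: (hz); rewrite -{2}e => /mq qz.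
by move: zq; rewrite -(prefix_size p) ?uncodeK ?ltnn // size_mkseq.
Qed.

End Bounded.

(* At stage N at most [2 ^- (c + 1 + j)] of the measure of the set with index j is missing; with
   denominators cleared. *)
Definition accurate j c N := (c + 1 + j <= N)%N && (a j N + 1 <=
  count (stage BA j N) (strings N [::]) + 2 ^ (N - (c + 1 + j)) + b j N)%N.

Lemma accurate_dec n (f g h : ctx n -> nat) : cmp f -> cmp g -> cmp h ->
  dec (fun x => accurate (f x) (g x) (h x)).
Proof.
apply: (@cmp_comp3 (fun i j t => nat_of_bool (accurate i j t))).
have ce : cmp (fun y : ctx 3 => y.1.2 + 1 + y.1.1.2)%N.
  by apply: cmp_add; [apply: cmp_add; [cvar | exact: cmp_const] | cvar].
apply: dec_and; first by apply: dec_leq => //; cvar.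
apply: dec_leq.
  by apply: cmp_add; [apply: (cmp_comp2 ca); cvar | exact: cmp_const].
apply: cmp_add; last by apply: (cmp_comp2 cb); cvar.
apply: cmp_add; last first.
  by apply: cmp_exp; [exact: cmp_const | apply: cmp_sub => //; cvar].
apply: (@cmp_count_strings 3 (fun y x => stage BA y.1.1.2 y.2 x) (fun y => y.2)); last by cvar.
by apply: (dec_stage sA.1); cvar.
Qed.

Lemma accurate_ex j c : exists N, accurate j c N.
Proof.
pose s := uncode j; have sj : code s = j by exact: uncodeK.
pose e := (c + 1 + j)%N; have e0 : 0 < (2 : R) ^- e by rewrite invr_gt0 pow2_gt0.
(* Half of the allowed defect [2 ^- e] is spent on the density; the other half, scaled by [2 ^ m]
   with [m] at least [e + 2], is at least 2 and absorbs the approximation error and the extra 1 in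
   [accurate]. *)
have [N hN] : exists N, rho s - 2 ^- e / 2 < dens R (A s) N.
  apply: contrapT => /forallNP h.
  have := @rho_lub s (rho s - 2 ^- e / 2).
  by move=> /(_ _)/wrap[N|]; [rewrite leNgt; exact/negP | lra].
have [X|M NM hM] := @dens_compact R (A s) (fun y => stage BA j (size y) y) N
  (@upclosed_stage_size _ _).
  by rewrite AE sj => /(sigma1_cyl _ _ sA)[n hn]; exists n; rewrite size_mkseq.
pose m := maxn M (e + 2); exists m; rewrite /accurate -/e.
have em : (e + 2 <= m)%N by exact: leq_maxr.
apply/andP; split; first by lia.
have V : 0 < (2 : R) ^+ m by exact: pow2_gt0.
rewrite -(ler_nat R) !natrD natrX; set n := count _ _.
have hn : (rho s - 2 ^- e / 2) * 2 ^+ m <= n%:R.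
  rewrite -ler_pdivlMr //; apply: le_trans (ltW hN) _; apply: le_trans hM _.
  apply: le_trans (frac_mono R (@upclosed_stage_size BA j) (leq_maxl M (e + 2))) _.
  by apply: frac_le => x sx; rewrite sx.
have he : 2 ^- e * 2 ^+ m = 2 ^+ (m - e) :> R.
  by rewrite expfB_cond ?pnatr_eq0 //; [rewrite mulrC | lia].
have h4 : 4 <= (2 : R) ^+ (m - e).
  rewrite (_ : 4 = 2 ^+ 2); last by rewrite expr2; lra.
  by rewrite ler_eXn2l //; [lia | lra].
have := abP_scaled s m; rewrite sj ler_norml => /andP[h' _].
move: hn h' h4; rewrite mulrBl (mulrAC (2 ^- e)) he; move: (a _ _)%:R (b _ _)%:R => u v; lra.
Qed.

Lemma accurate_sound j c N : accurate j c N ->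
  rho (uncode j) - 2 ^- (c + 1 + j) <= frac R (stage BA j N) N.
Proof.
move=> /andP[eN]; set e := (c + 1 + j)%N in eN *.
have V : 0 < (2 : R) ^+ N by exact: pow2_gt0.
rewrite -(ler_nat R) !natrD natrX /frac ler_pdivlMr //; set n := count _ _ => h.
have he : 2 ^- e * 2 ^+ N = 2 ^+ (N - e) :> R.
  by rewrite expfB_cond ?pnatr_eq0 // mulrC.
have := abP_scaled (uncode j) N; rewrite uncodeK ler_norml => /andP[_ h'].
by rewrite mulrBl he; lra.
Qed.

(* The points that enter some A s after a stage at which almost all of its measure is present;
   off the cylinder of late c, every A s is clopen. *)
Definition late c : set str := [set x | exists N M j, [/\ (N <= size x)%N, accurate j c N,
  stage BA j M x & ~~ stage BA j N x]].

(** Of the three witnesses [j] is bounded by [M], which leaves two for [sigma1_ex2]; [M] may be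
    enlarged because stages grow. *)
Lemma late_sigma1 : exists B, sigma1 B late.
Proof.
pose D c z N M := (N <= size (uncode z))%N && has (fun j =>
  [&& accurate j c N, stage BA j M (uncode z) & ~~ stage BA j N (uncode z)]) (iota 0 M.+1).
have dD : dec (fun y : ctx 4 => D y.1.1.1.2 y.1.1.2 y.1.2 y.2).
  apply: dec_and; first by apply: dec_leq; [cvar | apply: cmp_size; cvar].
  apply: (@dec_has 4 (fun y j => [&& accurate j y.1.1.1.2 y.1.2, stage BA j y.2 (uncode y.1.1.2)
     & ~~ stage BA j y.1.2 (uncode y.1.1.2)]) (fun y => y.2.+1)); last by apply: cmp_succ; cvar.
  apply: dec_and; first by apply: accurate_dec; cvar.
  apply: dec_and; first by apply: (dec_stage sA.1); cvar.
  by apply: dec_neg; apply: (dec_stage sA.1); cvar.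
eexists; apply: (sigma1_ex2 dD) => c s; rewrite /D codeK; split.
  move=> [N [M [j [h1 h2 h3 h4]]]]; exists N, (maxn M j); rewrite h1 andTb.
  apply/hasP; exists j; first by rewrite mem_iota ltnS leq_maxr.
  by rewrite h2 h4 andbT; exact: stage_mono (leq_maxl _ _) (prefix_refl _) h3.
by move=> [N [M /andP[h1 /hasP[j _ /and3P[h2 h3 h4]]]]]; exists N, M, j.
Qed.

(** For fixed [j], a point of [A (uncode j)] missing at some accurate stage is missing at the least
    one, where by [accurate_sound] at most [2 ^- (c + 1 + j)] of the measure is missing; these
    bounds sum to at most [2 ^- c]. *)
Lemma late_dens c N : dens R (cyl (late c)) N <= 2 ^- c.
Proof.
pose C j : set cantor := [set X | exists n, [/\ accurate j c n, A (uncode j) X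
  & ~~ stage BA j n (mkseq X n)]].
apply: le_trans (_ : dens R [set X | exists j, C j X] N <= _).
  apply: sub_dens => X [x [n [M [j [h1 h2 h3 h4]]]] p]; exists j, n; split=> //.
    by rewrite AE uncodeK; exact: stage_cyl sA p h3.
  apply: contra h4; apply: stage_mono => //.
  by apply: pre_prefix (@pre_mkseq _ _) p _; rewrite size_mkseq.
apply: (dens_bigcup (r := fun j => 2 ^- (c + 1 + j))).
- move=> j X [n [h1 h2 h3]]; have [m hm] := isopen_A h2.
  exists (maxn n m) => Z p; exists n; split=> //.
    apply: hm; apply: prefix_pre p.
    by apply: pre_prefix (@pre_mkseq _ _) (@pre_mkseq _ _) _; rewrite !size_mkseq leq_maxr.
  suff <- : mkseq X n = mkseq Z n by [].
  apply: prefix_size; last by rewrite !size_mkseq.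
  apply: pre_prefix (@pre_mkseq _ _) _; last by rewrite !size_mkseq.
  apply: prefix_pre p.
  by apply: pre_prefix (@pre_mkseq _ _) (@pre_mkseq _ _) _; rewrite !size_mkseq leq_maxl.
- move=> j M; have := ex_minnP (accurate_ex j c) => -[n gn mn].
  apply: le_trans (dens_mono R (C j) (leq_maxl M n)) _; set m := maxn M n.
  have nm : (n <= m)%N by exact: leq_maxr.
  (* The late part and the least accurate stage are disjoint parts of [A (uncode j)]. *)
  have : dens R (C j) m + frac R (stage BA j n) m <= rho (uncode j).
    apply: le_trans (rho_ub _ m).
    pose p (i : bool) := if i then inside (C j) else stage BA j n.
    have := @sum_frac_le R _ [:: true; false] p (inside (A (uncode j))) m.
    rewrite !big_cons big_nil addr0; apply => x sx.
    rewrite !big_cons big_nil addn0 /p.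
    case c1 : (inside (C j) x); case c2 : (stage BA j n x) => //=.
    - have [X pX] := extend_pre x; move/asboolP: c1 => /(_ _ pX)[n' [g' _]].
      by rewrite (stage_mkseq c2 pX) // mn.
    - by rewrite (inside_sub _ c1) // => X [n' []].
    - rewrite (_ : inside _ _) //; apply/asboolP => X pX.
      by rewrite AE uncodeK; exact: stage_cyl sA pX c2.
  have := frac_mono R (@upclosed_stage BA j n) nm.
  have := accurate_sound gn; lra.
move=> K; suff -> : \sum_(j <- iota 0 K) 2 ^- (c + 1 + j) = 2 ^- c - 2 ^- (c + K) :> R.
  by rewrite lerBlDr lerDl invr_ge0 ltW // pow2_gt0.
elim: K => [|K IH]; first by rewrite big_nil addn0 subrr.
rewrite -[X in iota 0 X]addn1 iotaD big_cat IH big_seq1 /= add0n.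
rewrite addn1 addSn !addnS exprS invfM; lra.
Qed.

(** If [X] entered only after the accurate stage [N], a long enough prefix of [X] would belong to
    [late c]. *)
Lemma late_clopen c j N X : ~ cyl (late c) X -> accurate j c N -> A (uncode j) X ->
  stage BA j N (mkseq X N).
Proof.
move=> nX g; rewrite AE uncodeK => /(sigma1_cyl _ _ sA)[M hM]; apply: contraT => h.
case: nX; exists (mkseq X (maxn N M)); last exact: pre_mkseq.
exists N, (maxn N M), j; split=> //.
- by rewrite size_mkseq leq_maxl.
- by apply: (stage_mkseq hM (@pre_mkseq _ _)); exact: leq_maxr.
- by apply: contra h => h; exact: stage_mkseq h (@pre_mkseq _ _) (leqnn _).
Qed.

End Core.

(** * The random preimage *)

(** The leading tag separates the constructors, which makes the numbering injective; it serves to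
    list the countably many tests. *)
Fixpoint prf_code (f : prf) : nat :=
  match f with
  | PZero => CodeSeq.code [:: 0%N]
  | PSucc => CodeSeq.code [:: 1%N]
  | PProj i => CodeSeq.code [:: 2; i]
  | PComp f gs => CodeSeq.code [:: 3, prf_code f & map prf_code gs]
  | PPrec f g => CodeSeq.code [:: 4; prf_code f; prf_code g]
  | PMu f => CodeSeq.code [:: 5; prf_code f]
  end.

Lemma prf_code_inj : injective prf_code.
Proof.
move=> f; pose Q gs := forall hs, map prf_code gs = map prf_code hs -> gs = hs.
apply: (@prf_ind_nested (fun f => forall g, prf_code f = prf_code g -> f = g) Q) => {f};
  rewrite /Q.
- by case=> [| |i|f gs|f g|f] /(can_inj CodeSeq.codeK).
- by case=> [| |i|f gs|f g|f] /(can_inj CodeSeq.codeK).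
- by move=> j [| |i|f gs|f g|f] /(can_inj CodeSeq.codeK) // [->].
- by move=> f gs IHf IHgs [| |i|f' gs'|f' g|f'] /(can_inj CodeSeq.codeK) // [/IHf -> /IHgs ->].
- by move=> f g IHf IHg [| |i|f' gs'|f' g'|f'] /(can_inj CodeSeq.codeK) // [/IHf -> /IHg ->].
- by move=> f IHf [| |i|f' gs'|f' g'|f'] /(can_inj CodeSeq.codeK) // [/IHf ->].
- by case.
- by move=> g gs IHg IHgs [|h hs] //= [/IHg -> /IHgs ->].
Qed.

(** * Avoiding all tests and passing to the limit *)

Section Limit.
Variables (R : realType) (A : str -> set cantor) (G : nat -> set str).
Variables (BA : nat -> nat -> nat -> bool) (rho : str -> R) (a b : nat -> nat -> nat).
Hypothesis AE : forall s, A s = cyl (G (code s)).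
Hypothesis sA : sigma1 BA G.
Hypothesis A_sub : forall s t, prefix s t -> A t `<=` A s.
Hypothesis A_comp : forall s t X, A s X -> A t X -> prefix s t || prefix t s.
Hypothesis rho_ub : forall s N, dens R (A s) N <= rho s.
Hypothesis rho_lub : forall s r, (forall N, dens R (A s) N <= r) -> rho s <= r.
Hypothesis ca : cmp (fun y : ctx 2 => a y.1.2 y.2).
Hypothesis cb : cmp (fun y : ctx 2 => b y.1.2 y.2).
Hypothesis abP : forall s N,
  `|rho s - ((a (code s) N)%:R - (b (code s) N)%:R) / 2 ^+ N| <= 2 ^- N.
Variable Y : cantor.
Hypothesis mlrY : MLR_rho rho Y.

Let bounded := bounded_level AE sA A_sub A_comp rho_ub rho_lub ca cb abP.

(** A prefix of [Y] of weight 0 would give a constant test capturing [Y]. *)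
Lemma rho_gt0 n : 0 < rho (mkseq Y n).
Proof.
set s := mkseq Y n.
have r0 : 0 <= rho s by apply: le_trans (rho_ub s 0); exact: frac_ge0.
rewrite lt_neqAle r0 andbT; apply/eqP => e.
pose U (i : nat) : set str := [set s].
have tU : ML_test rho U.
  split.
    apply: (@sigma1_unif_ce (fun i j t => j == code s)); split.
      by apply: dec_eq; [exact: (@cmp_var 1 3) | exact: cmp_const].
    move=> i t; split=> [->|[_ /eqP/code_inj //]]; by exists 0.
  move=> i l _ lU; rewrite big_seq big1 ?invr_ge0 ?ltW ?pow2_gt0 // => t /lU ->.
  by rewrite -e.
by apply: (mlrY tU) => i; exists s => //; exact: pre_mkseq.
Qed.

(** If [e] is the number of no program, all components are empty. *)
Let nth_test e i s := exists2 g, prf_code g = e & halts g [:: i; code s].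

(** Index 0 is reserved for [late] and index [e.+1] for the family numbered [e], which is
    constrained only if it is a test. The factors [2 ^- (j + 2)] sum to at most one half. *)
Let null_part j (W : set cantor) := [/\ isopen W,
  forall n N, dens R (W `&` A (mkseq Y n)) N <= 2 ^- (j + 2) * rho (mkseq Y n) &
  match j with
  | 0 => exists c, W = cyl (late BA a b c)
  | e.+1 => ML_test (fun s : str => (2 : R) ^- size s) (nth_test e) ->
      exists c, W = cyl (nth_test e c)
  end].

Lemma null_part_ex j : exists W, null_part j W.
Proof.
have ofTest (O : nat -> set str) : unif_ce O -> (forall c N, dens R (cyl (O c)) N <= 2 ^- c) ->
    exists c, forall n N, dens R (cyl (O c) `&` A (mkseq Y n)) N
      <= 2 ^- (j + 2) * rho (mkseq Y n).
  by move=> /unif_ce_sigma1[B sB] hO; exact: (bounded _ sB hO mlrY).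
case: j ofTest => [|e] ofTest.
  have [|c hc] := ofTest _ _ (late_dens AE sA rho_ub rho_lub abP).
    by have [B /sigma1_unif_ce] := late_sigma1 sA ca cb.
  by exists (cyl (late BA a b c)); split=> //; [exact: isopen_cyl | exists c].
have [tU|nU] := pselect (ML_test (fun s : str => (2 : R) ^- size s) (nth_test e)).
  have [|c hc] := ofTest _ tU.1; first by move=> c N; apply: dens_cyl_le; exact: tU.2.
  by exists (cyl (nth_test e c)); split=> //; [exact: isopen_cyl | exists c].
exists set0; split=> // n N; rewrite set0I dens_set0 mulr_ge0 ?ltW ?rho_gt0 //.
Qed.

(** Each [A (mkseq Y n)] has a point outside all [W j]. If no point did this for all [n] at once,
    every sequence would show finite evidence of its failure, by compactness at one common level
    [K]; the point found for [n = K] contradicts this. *)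
Theorem random_preimage : exists2 X, @MLR R X & forall n, A (mkseq Y n) X.
Proof.
have [W hW] := choice null_part_ex.
have oW j : isopen (W j) by have [] := hW j.
have avoid n : exists2 X, A (mkseq Y n) X & forall j, ~ W j X.
  apply: contrapT => /forall2NP h; set s := mkseq Y n in h *.
  have AW : A s `<=` [set X | exists j, (W j `&` A s) X].
    by move=> X AX; have [//|/existsNP[j /contrapT Wj]] := h X; exists j.
  have := rho_gt0 n; rewrite -/s ltNge => /negP; apply.
  suff : rho s <= rho s / 2 by lra.
  apply: rho_lub => N; apply: le_trans (sub_dens R N AW) _.
  apply: (dens_bigcup (r := fun j => 2 ^- (j + 2) * rho s)).
  - by move=> j; apply: isopenI => //; exact: isopen_A AE _.
  - by move=> j M; have [_ + _] := hW j; exact.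
  move=> K; rewrite -mulr_suml mulrC ler_pM2l ?rho_gt0 //.
  suff -> : \sum_(j <- iota 0 K) 2 ^- (j + 2) = 2^-1 - 2 ^- (K + 1) :> R.
    by rewrite lerBlDr lerDl invr_ge0 ltW // pow2_gt0.
  elim: K => [|K IH]; first by rewrite big_nil add0n expr1 subrr.
  rewrite -[X in iota 0 X]addn1 iotaD big_cat IH big_seq1 /= add0n.
  rewrite addn2 !addn1 (exprS _ K.+1) invfM; lra.
have [c Wc] : exists c, W 0 = cyl (late BA a b c) by have [_ _] := hW 0.
apply: contrapT => /forall2NP none.
(* [P y] refutes the extensions of [y]: they all lie in one [W j], or they are absent from
   [A (mkseq Y n)] at an accurate stage, which off [W 0] excludes them for good. The bound on [N]
   makes [P] upward closed; the one on [n] gives [n <= K] at level [K]. *)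
pose P y := `[< (exists j, inside (W j) y) \/
  exists n N, [/\ accurate BA a b (code (mkseq Y n)) c N,
  (n <= size y)%N, (N <= size y)%N & ~~ stage BA (code (mkseq Y n)) N y] >].
have upP : upclosed P.
  move=> x y xy /asboolP[[j jx]|[n [N [g nx Nx h]]]]; apply/asboolP.
    by left; exists j; exact: upclosed_inside jx.
  have xy' := size_prefix xy.
  right; exists n, N; split=> //; [exact: leq_trans xy' | exact: leq_trans xy' |].
  apply: contra h => h; have [X pX] := extend_pre y.
  apply: stage_mono (leqnn N) _ (stage_mkseq h pX (leqnn N)).
  by apply: pre_prefix (@pre_mkseq _ _) (prefix_pre xy pX) _; rewrite size_mkseq.
have [X _|K hK] := @compactness P [::] upP.
  have [[j Wj]|nW] := pselect (exists j, W j X).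
    by have [n hn] := oW _ _ Wj; exists n; apply/asboolP; left; exists j; exact/asboolP.
  have [n nA] : exists n, ~ A (mkseq Y n) X.
    apply: contrapT => /forallNP h.
    (* Otherwise [X] lies in all these sets and is random, against [none]: every test is [nth_test]
       at the number of its program, and [X] avoids the component placed in [W]. *)
    have [nM|nA] := none X; last by apply: nA => n; exact: contrapT (h n).
    apply: nM.
    move=> U [[f hf] tU]; have UE : nth_test (prf_code f) = U.
      apply/funext => i; apply/seteqP; split=> s.
        by move=> [g /prf_code_inj -> /hf].
      by move=> /hf hs; exists f.
    have [_ _ /=] := hW (prf_code f).+1; rewrite UE.
    move=> /(_ (conj (ex_intro _ f hf) tU))[k Wk] /(_ k); rewrite -Wk => WX.
    by apply: nW; exists (prf_code f).+1.
  have [N g] := accurate_ex AE sA rho_lub abP (code (mkseq Y n)) c.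
  exists (maxn n N); apply/asboolP; right; exists n, N.
  rewrite size_mkseq leq_maxl leq_maxr; split=> //.
  apply/negP => h; apply: nA; rewrite AE.
  exact: stage_cyl sA (@pre_mkseq _ _) h.
have [X AX nW] := avoid K.
have /(allP hK)/asboolP[[j /asboolP/(_ X (@pre_mkseq _ _)) //]|] : mkseq X K \in strings K [::].
  by rewrite strings0P size_mkseq.
  exact: nW.
move=> [n [N []]]; rewrite size_mkseq => g nK NK /negP; apply.
have AnX : A (uncode (code (mkseq Y n))) X.
  rewrite codeK; apply: A_sub AX.
  by apply: pre_prefix (@pre_mkseq _ _) (@pre_mkseq _ _) _; rewrite !size_mkseq.
have := late_clopen AE sA _ g AnX; rewrite -Wc => /(_ (nW 0)).
apply: stage_mono (leqnn N) _.
by apply: pre_prefix (@pre_mkseq _ _) (@pre_mkseq _ _) _; rewrite !size_mkseq.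
Qed.

End Limit.

(** * The open sets of a Turing functional *)

Section Functional.
Variable Phi : str -> str -> Prop.
Hypothesis tPhi : turing_functional Phi.

Lemma Phi_comparable s t s' t' X : Phi s t -> Phi s' t' -> pre s X -> pre s' X ->
  prefix t t' || prefix t' t.
Proof.
move=> p p' h h'; case/orP: (leq_total (size s) (size s')) => ss.
  exact: tPhi.2 p p' (pre_prefix h h' ss).
by rewrite orbC; exact: tPhi.2 p' p (pre_prefix h' h ss).
Qed.

Lemma nth_prefix (s t : str) i : prefix s t -> (i < size s)%N -> nth false s i = nth false t i.
Proof. by move=> /prefixP[u ->] si; rewrite nth_cat si. Qed.

Lemma PhiX_nth s t X i c : Phi s t -> pre s X -> (i < size t)%N -> PhiX Phi X i c ->
  nth false t i = c.
Proof.
move=> p h ti [s' [t' [p' h' ti' <-]]].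
by case/orP: (Phi_comparable p p' h h') => /nth_prefix ->.
Qed.

Lemma PhiX_ext_prefix X s t : prefix s t -> PhiX_ext Phi X t -> PhiX_ext Phi X s.
Proof.
move=> p h i si; rewrite (nth_prefix p si); apply: h.
exact: leq_trans si (size_prefix p).
Qed.

Lemma PhiX_ext_comparable X s t : PhiX_ext Phi X s -> PhiX_ext Phi X t ->
  prefix s t || prefix t s.
Proof.
wlog st : s t / (size s <= size t)%N.
  move=> w hs ht; case/orP: (leq_total (size s) (size t)) => l; first exact: w.
  by rewrite orbC; exact: w.
move=> hs ht; apply/orP; left; rewrite prefixE; apply/eqP/(@eq_from_nth _ false).
  by rewrite size_takel.
move=> i; rewrite size_takel // => si; rewrite nth_take //.
have [u [v [p q iv <-]]] := hs _ si.
by apply/esym/(PhiX_nth p q iv)/ht/(leq_trans si).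
Qed.

(** The pair that yields the last bit of [s] yields all of them, as its output is comparable with
    every other output along [X]. The empty string is separate: it is extended even if no pair
    applies to [X]. *)
Lemma PhiX_extP X s : PhiX_ext Phi X s <-> 
  s = [::] \/ exists z t, [/\ Phi z t, pre z X & prefix s t].
Proof.
split=> [h|[-> //|[z [t [p q st]]] i si]]; last first.
  exists z, t; split=> //; first exact: leq_trans si (size_prefix st).
  by rewrite (nth_prefix st si).
case: (posnP (size s)) => [/size0nil|s0]; first by left.
have [|z [t [p q zt _]]] := h (size s).-1; first by rewrite prednK.
rewrite prednK // in zt; right; exists z, t; split=> //.
rewrite prefixE; apply/eqP/(@eq_from_nth _ false); first by rewrite size_takel.
move=> i; rewrite size_takel // => si; rewrite nth_take //.
exact: PhiX_nth p q (leq_trans si zt) (h i si).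
Qed.

(** The disjunct [j = 0] treats the empty string, whose code is 0 and whose set is the whole
    space. *)
Definition Phi_gen (j : nat) : set str :=
  [set z | j = 0%N \/ exists2 t, Phi z t & prefix (uncode j) t].

Lemma PhiX_ext_cyl s : [set X | PhiX_ext Phi X s] = cyl (Phi_gen (code s)).
Proof.
apply/seteqP; split=> X.
  move=> /PhiX_extP[->|[z [t [p q st]]]]; first by exists [::] => //; left.
  by exists z => //; right; exists t => //; rewrite codeK.
move=> [z [e|[t p st]] q]; apply/PhiX_extP.
  by left; rewrite -(codeK s) e -[0%N]/(code [::]) codeK.
by right; exists z, t; rewrite codeK in st.
Qed.

Lemma Phi_gen_sigma1 : exists B, sigma1 B Phi_gen.
Proof.
have [f hf] := tPhi.1; have [B dB hB] := halts_dec 2 f.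
pose D j z c t := (j == 0%N) ||
  B (((((tt, c), z) : ctx 2), t) : ctx 3) && prefix (uncode j) (uncode c).
have dD : dec (fun y : ctx 4 => D y.1.1.1.2 y.1.1.2 y.1.2 y.2).
  apply: dec_or; first by apply: dec_eq; [cvar | exact: cmp_const].
  apply: dec_and; last by apply: dec_prefix; cvar.
  apply: (cmp_comp (m := 3)
    (W := fun y : ctx 4 => ((((tt, y.1.2), y.1.1.2), y.2) : ctx 3)) _ dB).
  by do !apply: cmpv_cons; [exact: cmpv_nil | cvar | cvar | cvar].
eexists; apply: (sigma1_ex2 dD) => j s; split.
  move=> [->|[t /hf/(hB (((tt, code t), code s) : ctx 2))[n hn] p]]; first by exists 0%N, 0%N.
  by exists (code t), n; rewrite /D hn codeK p orbT.
move=> [c [t /orP[/eqP->|/andP[h p]]]]; first by left.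
right; exists (uncode c) => //; apply/hf; rewrite uncodeK.
by apply/(hB (((tt, c), code s) : ctx 2)); exists t.
Qed.

End Functional.

Lemma eval_cmp2 p (h : nat -> nat -> nat) : (forall j n, eval p [:: j; n] (h j n)) ->
  cmp (fun y : ctx 2 => h y.1.2 y.2).
Proof.
move=> hp; apply: (cmp_comp (m := 2) (W := fun y : ctx 2 => (((tt, y.2), y.1.2) : ctx 2))
  (f := fun y : ctx 2 => h y.2 y.1.2)).
  by do !apply: cmpv_cons; [exact: cmpv_nil | cvar | cvar].
by exists p => -[[[] n] j]; exact: hp.
Qed.

(** Values of [p] and [m] are picked by choice; as they are derivable, the same programs compute the
    chosen functions. *)
Lemma computable_approx (R : realType) (rho : str -> R) : computable_fun rho ->
  exists a b : nat -> nat -> nat, [/\ cmp (fun y : ctx 2 => a y.1.2 y.2),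
    cmp (fun y : ctx 2 => b y.1.2 y.2) &
    forall s N, `|rho s - ((a (code s) N)%:R - (b (code s) N)%:R) / 2 ^+ N| <= 2 ^- N].
Proof.
move=> [p [m h]].
have /choice[a] : forall x : str * nat, exists c, exists b,
    [/\ eval p [:: code x.1; x.2] c, eval m [:: code x.1; x.2] b &
        `|rho x.1 - (c%:R - b%:R) / (2%:R ^+ x.2)| <= (2%:R : R) ^- x.2].
  by move=> [s n]; exact: h.
move=> /choice[b hab]; exists (fun j n => a (uncode j, n)), (fun j n => b (uncode j, n)); split.
- apply: (@eval_cmp2 p (fun j n => a (uncode j, n))) => j n.
  by have [+ _ _] := hab (uncode j, n); rewrite /= uncodeK.
- apply: (@eval_cmp2 m (fun j n => b (uncode j, n))) => j n.
  by have [_ + _] := hab (uncode j, n); rewrite /= uncodeK.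
- by move=> s N; rewrite codeK; have [_ _] := hab (s, N).
Qed.

Theorem theorem3p4 (R : realType) (Phi : str -> str -> Prop) (rho : str -> R)
  (Y : cantor) :
  turing_functional Phi ->
  (forall s, (rho s)%:E = lamPhi Phi s) ->
  computable_fun rho ->
  MLR_rho rho Y ->
  exists X : cantor, [/\ @MLR R X, in_dom Phi X & Phi_maps Phi X Y].
Proof.
move=> tPhi rhoE /computable_approx[a [b [ca cb hab]]] mlrY.
have [B sB] := Phi_gen_sigma1 tPhi.
pose A s : set cantor := [set X | PhiX_ext Phi X s].
have AE s : A s = cyl (Phi_gen Phi (code s)) by exact: PhiX_ext_cyl.
have [||||X mlrX hX] := @random_preimage R A _ B rho a b AE sB _ _ _ _ ca cb hab Y mlrY.
- by move=> s t st X; exact: PhiX_ext_prefix.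
- by move=> s t X; exact: PhiX_ext_comparable.
- by move=> s N; rewrite -lee_fin rhoE; exact: dens_le_lam.
- move=> s r h; rewrite -lee_fin rhoE; apply: lam_le h.
  by rewrite -/(A s) AE; exact: isopen_cyl.
have XY : Phi_maps Phi X Y.
  by move=> n; have := hX n.+1 n; rewrite size_mkseq nth_mkseq // => /(_ (ltnSn n)).
by exists X; split=> // n; exists (Y n).
Qed.
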